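(* Let $H_1(s)\in\mathcal{RH}_\infty$ and $H_2(s)\in\mathcal{RH}_\infty$ be square ($n\times n$) transfer function matrices, connected in negative feedback with $H_1$ in the forward path and $H_2$ in the feedback path. Suppose that for each $s=j\omega$ with $\omega\in[0,\infty)$, at least one of the following holds (which one may depend on $\omega$): 1. (phase condition) $\hat{\alpha}_{\max}(H_1(j\omega))+\hat{\alpha}_{\max}(H_2(j\omega))<\pi$; 2. (gain condition) $\sigma_{\max}(H_1(j\omega))\,\sigma_{\max}(H_2(j\omega))<1$. Then the closed-loop system is ($\mathcal{L}_2$) stable.
   Context: $\mathcal{RH}_\infty$ is the space of rational, proper, stable transfer functions (matrices), representing bounded, causal linear time-invariant (LTI) operators on $\mathcal{L}_2$ signals. For $F\in\{\mathbb{R},\mathbb{C}\}$, $\mathcal{L}_2^n(F)$ is the space of square-integrable signals $u:\mathbb{R}_{\ge 0}\to F^n$ with inner product $\langle u,y\rangle=\int_0^\infty u(t)^*y(t)\,dt$ and norm $\|u\|=\sqrt{\langle u,u\rangle}$. For a matrix $A\in\mathbb{C}^{n\times n}$, the maximum gain is the largest singular value $$\sigma_{\max}(A)=\max_{u\in\mathbb{C}^n,\ \|u\|=1}\frac{\|Au\|}{\|u\|},$$ and the maximum phase is $$\hat{\alpha}_{\max}(A)=\max_{u\in\mathbb{C}^n,\ \|u\|=1,\ \|Au\|\neq 0}\ \arccos\left(\frac{\Re\langle Au,u\rangle}{\|Au\|\,\|u\|}\right),$$ with $\hat{\alpha}_{\max}(A)=0$ if $\|Au\|=0$ for all $u$ with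 $\|u\|=1$. Here $j$ is the imaginary unit. Feedback interconnection: with external input $u$, error $e$ and output $y$, the loop is $e=u-H_2y$, $y=H_1e$; the closed-loop system is the system from $u$ to $y$. A system is $\mathcal{L}_2$ stable if every (bounded) input $u\in\mathcal{L}_2$ produces a (bounded) output $y\in\mathcal{L}_2$.
   Formalization: The phase-or-gain alternative is also required at ω = ∞, for the limits H_i(j∞); with ω in [0,∞) only, the claim fails, e.g. for n = 1, H_2 = 1, H_1 = −2s/(s+1), whose closed loop −2s/(1−s) has a pole at s = 1. *)

(* Defs.v *)
From HB Require Import structures.
From mathcomp Require Import all_boot all_order all_algebra.
From mathcomp Require Import all_classical all_reals all_analysis.
From mathcomp Require Import complex.

Set Implicit Arguments.
Unset Strict Implicit.
Unset Printing Implicit Defensive.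

Import Order.TTheory GRing.Theory Num.Theory.
Import numFieldNormedType.Exports.

Local Open Scope classical_set_scope.
Local Open Scope ring_scope.
Local Open Scope complex_scope.

Section Vectors.
Context {R : realType}.

Definition cdot n (x y : 'cV[R[i]]_n) : R[i] := \sum_(k < n) (x k 0)^* * y k 0.

Definition vnorm n (x : 'cV[R[i]]_n) : R := Num.sqrt (complex.Re (cdot x x)).

Definition sigma_max n (A : 'M[R[i]]_n) : R :=
  sup [set vnorm (A *m u) / vnorm u | u in [set u : 'cV[R[i]]_n | vnorm u = 1]].

(* A supremum, because the maximum need not be attained when A is singular.
   If A *m u = 0 for every unit u, the set is empty and its sup is 0. *)
Definition alpha_max n (A : 'M[R[i]]_n) : R :=
  sup [set acos (complex.Re (cdot (A *m u) u) / (vnorm (A *m u) * vnorm u))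
      | u in [set u : 'cV[R[i]]_n | vnorm u = 1 /\ vnorm (A *m u) <> 0]].

End Vectors.

Section TransferFunctions.
Context {R : realType}.

Definition ceval (p : {poly R}) (s : R[i]) : R[i] :=
  (map_poly (real_complex R) p).[s].

(* Real-rational, proper, with no pole in the closed right half-plane. Only the
   values on that half-plane are constrained, and only they are ever used. *)
Definition RHoo n (H : R[i] -> 'M[R[i]]_n) : Prop :=
  forall i j, exists p q : {poly R},
    [/\ (size p <= size q)%N,
        (forall s, 0 <= complex.Re s -> ceval q s != 0) &
        (forall s, 0 <= complex.Re s -> H s i j = ceval p s / ceval q s)].

Definition jw (w : R) : R[i] := 0 +i* w.

(* H(j oo), the entrywise limit; it always exists for H in RHoo. *)
Definition at_infty n (H : R[i] -> 'M[R[i]]_n) : 'M[R[i]]_n :=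
  \matrix_(i, j)
    (lim (complex.Re (H (jw w) i j) @[w --> +oo])
     +i* lim (complex.Im (H (jw w) i j) @[w --> +oo])).

Definition phase_condition n (A B : 'M[R[i]]_n) : Prop :=
  alpha_max A + alpha_max B < pi.

Definition gain_condition n (A B : 'M[R[i]]_n) : Prop :=
  sigma_max A * sigma_max B < 1.

End TransferFunctions.

Inductive scalar_field := RealScalars | ComplexScalars.

(* Signals live on [0, +oo[; their values at negative times are ignored. *)
Section Signals.
Context {R : realType}.

Local Notation mu := (@lebesgue_measure R).
Local Notation time := (`[0%R, +oo[%classic : set R).

Definition valued (F : scalar_field) n (u : R -> 'cV[R[i]]_n) : Prop :=
  match F with
  | RealScalars => forall t k, 0 <= t -> complex.Im (u t k 0) = 0
  | ComplexScalars => True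
  end.

Definition L2 n (u : R -> 'cV[R[i]]_n) : Prop :=
  (forall k, measurable_fun time (fun t => complex.Re (u t k 0)) /\
             measurable_fun time (fun t => complex.Im (u t k 0))) /\
  (\int[mu]_(t in time) (complex.Re (cdot (u t) (u t)))%:E < +oo)%E.

Definition cexp (z : R[i]) : R[i] :=
  (expR (complex.Re z) * cos (complex.Im z))
  +i* (expR (complex.Re z) * sin (complex.Im z)).

Definition laplace_kernel n (u : R -> 'cV[R[i]]_n) (s : R[i]) (k : 'I_n)
    (t : R) : R[i] := cexp (- (s * t%:C)) * u t k 0.

Definition laplace_cvg n (u : R -> 'cV[R[i]]_n) (s : R[i]) : Prop :=
  forall k,
    mu.-integrable time (fun t => (complex.Re (laplace_kernel u s k t))%:E) /\
    mu.-integrable time (fun t => (complex.Im (laplace_kernel u s k t))%:E).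

Definition laplace n (u : R -> 'cV[R[i]]_n) (s : R[i]) : 'cV[R[i]]_n :=
  \col_k ((\int[mu]_(t in time) complex.Re (laplace_kernel u s k t))
          +i* (\int[mu]_(t in time) complex.Im (laplace_kernel u s k t)))%R.

(* y is the response to u (at rest for t < 0) of the system with transfer
   function H. The signals need only be Laplace transformable on some right
   half-plane, hence may grow exponentially: y is not assumed to be in L2. *)
Definition response n (H : R[i] -> 'M[R[i]]_n) (u y : R -> 'cV[R[i]]_n) : Prop :=
  exists2 sigma : R, 0 <= sigma &
    forall s, sigma < complex.Re s ->
      [/\ laplace_cvg u s, laplace_cvg y s & laplace y s = H s *m laplace u s].

(* Negative feedback: e = u - H2 y, y = H1 e. *)
Definition closed_loop (F : scalar_field) n (H1 H2 : R[i] -> 'M[R[i]]_n)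
    (u y : R -> 'cV[R[i]]_n) : Prop :=
  exists e z : R -> 'cV[R[i]]_n,
    [/\ valued F e /\ valued F z,
        response H2 y z,
        (forall t, 0 <= t -> e t = u t - z t) &
        response H1 e y].

(* The existence clause excludes loops that have no response to some input. *)
Definition L2_stable (F : scalar_field) n
    (S : (R -> 'cV[R[i]]_n) -> (R -> 'cV[R[i]]_n) -> Prop) : Prop :=
  forall u, valued F u -> L2 u ->
    (exists2 y, valued F y & S u y) /\
    (forall y, valued F y -> S u y -> L2 y).

End Signals.

(* Main.v *)
(* At every frequency, infinity included, the gain or the phase condition keeps
   -1 out of the spectrum of tau H1 H2 for all tau in [0, 1].  Clearing
   denominators, det (1 + tau H1 H2) becomes a family of polynomials of constant
   degree without roots on the imaginary axis.  That all roots lie in the open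
   left half-plane is then an open and closed condition on tau (by bounds read
   off the factorization into linear factors, which replace the argument
   principle), and it holds at tau = 0.  Hence (1 + H1 H2)^-1 H1 is proper and
   stable.  Its entries are built from constants and poles 1 / (s - r), each of
   which maps L2 signals to L2 signals; this gives a response in L2.  Any other
   response has the same Laplace transform on a right half-plane, so it agrees
   almost everywhere with this one. *)

Require Import Defs.
From mathcomp Require Import all_boot all_order all_algebra.
From mathcomp Require Import all_classical all_reals all_analysis.
From mathcomp Require Import complex.
From mathcomp Require Import perm measurable_realfun zify ring lra.

Import Order.TTheory GRing.Theory Num.Theory.
Import numFieldNormedType.Exports.
Import ComplexField.Normc.

Local Open Scope ring_scope.
Local Open Scope complex_scope.

Set Implicit Arguments.
Unset Strict Implicit.
Unset Printing Implicit Defensive.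

(** The condition at infinity has content of its own: strict inequalities at all finite frequencies
    may degenerate in the limit. For [n = 1], [H1 = s / (s + 1)] and [H2 = -1] satisfy the gain
    condition at every finite frequency, yet the closed loop is [s], a differentiator. Along the
    homotopy this condition keeps the degree of the determinant from dropping, so that no root comes
    in from infinity. The factor [tau] suits both conditions: a positive factor leaves angles
    unchanged, and a factor at most 1 does not increase the gain. The right half-plane is not
    compact, so the estimates that make the Hurwitz property open are uniform comparisons with
    [(1 + |s|)^N], where [N] is the common degree. The passage to signals is made in the time
    domain: for [Re r < 0] the kernel [exp (r t)] is integrable, and Cauchy-Schwarz with this kernel
    as weight bounds the energy of the output. A response is tied to its input only through Laplace
    transforms on some half-plane, which is why uniqueness of the transform is required before
    anything can be said about an arbitrary response. *)

Section ComplexModulus.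
Context {R : realType}.
Implicit Types (x y z : R[i]) (c : R).

Lemma cReD x y : complex.Re (x + y) = complex.Re x + complex.Re y.
Proof. by case: x y => [? ?] [? ?]. Qed.
Lemma cImD x y : complex.Im (x + y) = complex.Im x + complex.Im y.
Proof. by case: x y => [? ?] [? ?]. Qed.
Lemma cReN x : complex.Re (- x) = - complex.Re x.
Proof. by case: x. Qed.
Lemma cImN x : complex.Im (- x) = - complex.Im x.
Proof. by case: x. Qed.
Lemma cReM x y : complex.Re (x * y) =
  complex.Re x * complex.Re y - complex.Im x * complex.Im y.
Proof. by case: x y => [? ?] [? ?]. Qed.
Lemma cImM x y : complex.Im (x * y) =
  complex.Re x * complex.Im y + complex.Im x * complex.Re y.
Proof. by case: x y => [? ?] [? ?]. Qed.
Lemma cReJ x : complex.Re x^* = complex.Re x.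
Proof. by case: x. Qed.
Lemma cImJ x : complex.Im x^* = - complex.Im x.
Proof. by case: x. Qed.
Lemma cRe_sum (I : Type) (r : seq I) (P : pred I) (f : I -> R[i]) :
  complex.Re (\sum_(k <- r | P k) f k) = \sum_(k <- r | P k) complex.Re (f k).
Proof. by apply: (big_morph (@complex.Re R)) => // x y; rewrite cReD. Qed.
Lemma complexP x y :
  complex.Re x = complex.Re y -> complex.Im x = complex.Im y -> x = y.
Proof. by case: x y => [? ?] [? ?] /= -> ->. Qed.

Lemma normcE2 x : normc x = Num.sqrt (complex.Re x ^+ 2 + complex.Im x ^+ 2).
Proof. by case: x. Qed.
Lemma sqr_normcE x : normc x ^+ 2 = complex.Re x ^+ 2 + complex.Im x ^+ 2.
Proof. by rewrite normcE2 sqr_sqrtr// addr_ge0 ?sqr_ge0. Qed.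
Lemma normc_ge0 x : 0 <= normc x.
Proof. by rewrite normcE2 sqrtr_ge0. Qed.
Lemma normcD x y : normc (x + y) <= normc x + normc y.
Proof. exact: le_normcD. Qed.
Lemma normcB x y : normc x - normc y <= normc (x - y).
Proof. by rewrite lerBlDr -{1}(subrK y x) normcD. Qed.
Lemma normc_eq0 x : (normc x == 0) = (x == 0).
Proof. by apply/eqP/eqP => [/eq0_normc//|->]; rewrite normc0. Qed.
Lemma normc_gt0 x : (0 < normc x) = (x != 0).
Proof. by rewrite lt_neqAle eq_sym normc_eq0 normc_ge0 andbT. Qed.
Lemma normcX x n : normc (x ^+ n) = normc x ^+ n.
Proof. by elim: n => [|n IH]; rewrite ?expr0 ?normc1// !exprS normcM IH. Qed.
Lemma normc_real c : normc c%:C = `|c|.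
Proof. by rewrite normcE2/= expr0n addr0 sqrtr_sqr. Qed.
Lemma normc_sum (I : Type) (r : seq I) (P : pred I) (f : I -> R[i]) :
  normc (\sum_(k <- r | P k) f k) <= \sum_(k <- r | P k) normc (f k).
Proof.
elim/big_rec2: _ => [|i a b _ IH]; first by rewrite normc0.
by rewrite (le_trans (normcD _ _))// lerD2l.
Qed.
Lemma normc_prod (I : Type) (r : seq I) (P : pred I) (f : I -> R[i]) :
  normc (\prod_(k <- r | P k) f k) = \prod_(k <- r | P k) normc (f k).
Proof. by apply: (big_morph (@normc R)); [exact: normcM|exact: normc1]. Qed.
Lemma normc_geRe x : `|complex.Re x| <= normc x.
Proof. by rewrite -sqrtr_sqr normcE2 ler_sqrt ?lerDl ?addr_ge0 ?sqr_ge0. Qed.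
Lemma normc_geIm x : `|complex.Im x| <= normc x.
Proof. by rewrite -sqrtr_sqr normcE2 ler_sqrt ?lerDr ?addr_ge0 ?sqr_ge0. Qed.
Lemma normc_leD x : normc x <= `|complex.Re x| + `|complex.Im x|.
Proof.
rewrite normcE2 -[leRHS]ger0_norm ?addr_ge0// -sqrtr_sqr ler_wsqrtr//.
by rewrite sqrrD !real_normK ?num_real// lerD2r lerDl mulrn_wge0 ?mulr_ge0.
Qed.

End ComplexModulus.

(** * Gain, phase and the nonsingularity of [1 + tau A B] *)

Section GainPhase.
Context {R : realType}.
Local Notation C := R[i].
Implicit Types n : nat.

(** The Euclidean inner product of C^n seen as a real space of dimension 2n: symmetric and real
    bilinear. [alpha_max] involves only this real part. *)
Definition rdot n (x y : 'cV[C]_n) : R := complex.Re (cdot x y).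

Lemma rdotE n (x y : 'cV[C]_n) : rdot x y =
  \sum_k (complex.Re (x k 0) * complex.Re (y k 0) +
          complex.Im (x k 0) * complex.Im (y k 0)).
Proof.
rewrite /rdot /cdot cRe_sum; apply: eq_bigr => k _.
by rewrite cReM cReJ cImJ mulNr opprK.
Qed.

Lemma rdotxx n (x : 'cV[C]_n) : rdot x x = \sum_k normc (x k 0) ^+ 2.
Proof. by rewrite rdotE; apply: eq_bigr => k _; rewrite sqr_normcE !expr2. Qed.

Lemma rdotC n (x y : 'cV[C]_n) : rdot x y = rdot y x.
Proof. by rewrite !rdotE; apply: eq_bigr => k _; rewrite mulrC [X in _ + X]mulrC. Qed.

Lemma rdotDl n (x y z : 'cV[C]_n) : rdot (x + y) z = rdot x z + rdot y z.
Proof.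
rewrite !rdotE -big_split; apply: eq_bigr => k _ /=.
by rewrite mxE cReD cImD; ring.
Qed.

Lemma rdotZl n c (x y : 'cV[C]_n) : rdot (c%:C *: x) y = c * rdot x y.
Proof.
rewrite !rdotE mulr_sumr; apply: eq_bigr => k _ /=.
by rewrite mxE cReM cImM /=; ring.
Qed.

Lemma rdotZr n c (x y : 'cV[C]_n) : rdot x (c%:C *: y) = c * rdot x y.
Proof. by rewrite rdotC rdotZl rdotC. Qed.

Lemma rdotDr n (x y z : 'cV[C]_n) : rdot z (x + y) = rdot z x + rdot z y.
Proof. by rewrite rdotC rdotDl !(rdotC z). Qed.

Lemma rdotxx_ge0 n (x : 'cV[C]_n) : 0 <= rdot x x.
Proof. by rewrite rdotxx sumr_ge0// => k _; rewrite sqr_ge0. Qed.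

Lemma vnorm_ge0 n (x : 'cV[C]_n) : 0 <= vnorm x.
Proof. exact: sqrtr_ge0. Qed.

Lemma sqr_vnorm n (x : 'cV[C]_n) : vnorm x ^+ 2 = rdot x x.
Proof. by rewrite sqr_sqrtr// rdotxx_ge0. Qed.

Lemma vnorm_eq0 n (x : 'cV[C]_n) : (vnorm x == 0) = (x == 0).
Proof.
rewrite -sqrf_eq0 sqr_vnorm rdotxx psumr_eq0; last by move=> k _; rewrite sqr_ge0.
apply/allP/eqP => [h|-> k _]; last by rewrite mxE sqrf_eq0 normc_eq0/=.
apply/matrixP => k j; rewrite ord1 mxE; apply/eqP.
by have := h k (mem_index_enum k); rewrite /= sqrf_eq0 normc_eq0.
Qed.

Lemma vnorm_gt0 n (x : 'cV[C]_n) : (0 < vnorm x) = (x != 0).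
Proof. by rewrite lt_neqAle eq_sym vnorm_eq0 vnorm_ge0 andbT. Qed.

Lemma vnormZ n c (x : 'cV[C]_n) : vnorm (c%:C *: x) = `|c| * vnorm x.
Proof.
apply: (@pexpIrn _ 2) => //; rewrite ?nnegrE ?mulr_ge0 ?vnorm_ge0//.
by rewrite exprMn !sqr_vnorm rdotZl rdotZr mulrA real_normK ?num_real// expr2.
Qed.

(** Expanding the squared norm of [|y| x - s |x| y] for [s = 1] and [s = -1] gives
    [2 |x| |y| (|x| |y| - s rdot x y) >= 0], and the positive factor is divided out. *)
Lemma normr_rdot n (x y : 'cV[C]_n) : `|rdot x y| <= vnorm x * vnorm y.
Proof.
have [x0|x0] := eqVneq x 0.
  by rewrite {1}x0 -[0](scale0r (0 : 'cV_n)) -[0]/(0%:C) rdotZl mul0r normr0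
    mulr_ge0 ?vnorm_ge0.
have [y0|y0] := eqVneq y 0.
  by rewrite {1}y0 -[0](scale0r (0 : 'cV_n)) -[0]/(0%:C) rdotZr mul0r normr0
    mulr_ge0 ?vnorm_ge0.
have p : 0 < vnorm x * vnorm y by rewrite mulr_gt0 ?vnorm_gt0.
have h s : s ^+ 2 = 1 -> s * rdot x y <= vnorm x * vnorm y.
  move=> s1.
  have := rdotxx_ge0 ((vnorm y)%:C *: x + (- s * vnorm x)%:C *: y).
  rewrite rdotDl !rdotDr !rdotZl !rdotZr (rdotC y x) -!sqr_vnorm => h.
  have {}h : 0 <= 2 * (vnorm x * vnorm y) * (vnorm x * vnorm y - s * rdot x y).
    apply: le_trans h _; rewrite le_eqVlt; apply/orP; left; apply/eqP.
    have -> : - s * vnorm x * (- s * vnorm x * vnorm y ^+ 2) =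
      s ^+ 2 * (vnorm x ^+ 2 * vnorm y ^+ 2) by ring.
    by rewrite s1; ring.
  by rewrite -subr_ge0 -(pmulr_rge0 _ (mulr_gt0 (ltr0n _ 2) p)).
rewrite ler_norml; have := h 1; have := h (-1).
rewrite sqrrN expr1n => /(_ erefl) h1 /(_ erefl) h2; apply/andP; split; lra.
Qed.

Lemma cos_angle_bounds n (x y : 'cV[C]_n) :
  -1 <= rdot x y / (vnorm x * vnorm y) <= 1.
Proof.
rewrite -ler_norml normrM normfV [X in _ / X]ger0_norm ?mulr_ge0 ?vnorm_ge0//.
have [->|p] := eqVneq (vnorm x * vnorm y) 0; first by rewrite invr0 mulr0.
by rewrite ler_pdivrMr ?mul1r ?normr_rdot// lt_neqAle eq_sym p mulr_ge0 ?vnorm_ge0.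
Qed.

(** Angles are invariant under positive scaling, so the unit vectors in [alpha_max] account for all
    vectors; [acos <= pi] bounds the set, which makes its [sup] an upper bound. *)
Lemma alpha_max_ub n (A : 'M[C]_n) (u : 'cV[C]_n) : A *m u != 0 ->
  acos (rdot (A *m u) u / (vnorm (A *m u) * vnorm u)) <= alpha_max A.
Proof.
move=> Au0; have u0 : u != 0 by apply: contra Au0 => /eqP->; rewrite mulmx0.
have nu := u0; rewrite -vnorm_gt0 in nu.
have nAu := Au0; rewrite -vnorm_gt0 in nAu.
pose v := (vnorm u)^-1%:C *: u.
have nv : vnorm v = 1 by rewrite vnormZ gtr0_norm ?invr_gt0// mulVf ?gt_eqF.
have Av : A *m v = (vnorm u)^-1%:C *: (A *m u) by rewrite scalemxAr.
apply: (@sup_upper_bound R).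
  split; first by exists (acos (rdot (A *m v) v / (vnorm (A *m v) * vnorm v)));
    exists v => //; split=> //; apply/eqP; rewrite vnorm_eq0 Av scaler_eq0
    negb_or Au0 andbT -normc_eq0 normc_real normr_eq0 invr_eq0 gt_eqF.
  by exists pi => _ [w [_ _] <-]; exact/acos_lepi/cos_angle_bounds.
exists v.
  by split=> //; apply/eqP; rewrite vnorm_eq0 Av scaler_eq0
    negb_or Au0 andbT -normc_eq0 normc_real normr_eq0 invr_eq0 gt_eqF.
rewrite -/(rdot _ _) nv Av rdotZl rdotZr vnormZ gtr0_norm ?invr_gt0//; congr acos.
by field; rewrite !gt_eqF.
Qed.

Lemma vnorm_le_sum n (x : 'cV[C]_n) : vnorm x <= \sum_k normc (x k 0).
Proof.
rewrite -(@ler_pXn2r _ 2)// ?nnegrE ?vnorm_ge0 ?sumr_ge0//; last first.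
  by move=> k _; exact: normc_ge0.
rewrite sqr_vnorm rdotxx.
rewrite expr2 mulr_suml; apply: ler_sum => k _; rewrite expr2.
rewrite ler_wpM2l ?normc_ge0// (bigD1 k)//= lerDl sumr_ge0// => j _.
exact: normc_ge0.
Qed.

Lemma normc_le_vnorm n (x : 'cV[C]_n) k : normc (x k 0) <= vnorm x.
Proof.
rewrite -(@ler_pXn2r _ 2)// ?nnegrE ?vnorm_ge0 ?normc_ge0// sqr_vnorm rdotxx.
by rewrite (bigD1 k)//= lerDl sumr_ge0// => j _; rewrite sqr_ge0.
Qed.

Lemma sigma_max_ub n (A : 'M[C]_n) (u : 'cV[C]_n) :
  vnorm (A *m u) <= sigma_max A * vnorm u.
Proof.
have [->|u0] := eqVneq u 0.
  by rewrite mulmx0 (eqP (_ : vnorm 0 == 0)) ?vnorm_eq0// mulr0.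
have nu := u0; rewrite -vnorm_gt0 in nu.
pose v := (vnorm u)^-1%:C *: u.
have nv : vnorm v = 1 by rewrite vnormZ gtr0_norm ?invr_gt0// mulVf ?gt_eqF.
have Av : A *m v = (vnorm u)^-1%:C *: (A *m u) by rewrite scalemxAr.
rewrite -ler_pdivrMr//; apply: (@sup_upper_bound R); last first.
  by exists v => //; rewrite nv divr1 Av vnormZ gtr0_norm ?invr_gt0// mulrC.
split; first by exists (vnorm (A *m v) / vnorm v); exists v.
(* A crude bound on the set of gains: the coordinates of a unit vector have modulus at most 1. *)
exists (\sum_i \sum_j normc (A i j)) => _ [w w1 <-].
rewrite w1 divr1 (le_trans (vnorm_le_sum _))// ler_sum// => i _.
rewrite mxE (le_trans (normc_sum _ _ _))// ler_sum// => j _.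
by rewrite normcM ler_piMr ?normc_ge0// -w1 normc_le_vnorm.
Qed.

Lemma sigma_max_ge0 n (A : 'M[C]_n) : 0 <= sigma_max A.
Proof.
rewrite /sigma_max; set S := (X in sup X).
(* For [n = 0] there is no unit vector, and [sup] is 0 on the empty set. *)
have [->|/set0P[r Sr]] := eqVneq S classical_sets.set0; first by rewrite sup0.
have r0 : 0 <= r by case: Sr => u _ <-; rewrite divr_ge0 ?vnorm_ge0.
apply: (le_trans r0); apply: (@sup_upper_bound R) => //.
split; first by exists r.
exists (sigma_max A) => _ [w w1 <-].
by rewrite w1 divr1 -[leRHS]mulr1 -w1 sigma_max_ub.
Qed.

(** A kernel vector [x] gives [y = B x] with [A y = - x / tau]. The angle between [A y] and [y] is
    then pi minus the angle between [B x] and [x]: the two add up to exactly pi, against the phase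
    condition, without any triangle inequality for angles. The norms give
    [|x| <= sigma_max A * sigma_max B * |x|], against the gain condition. *)
Lemma phase_gain_nonsingular n (A B : 'M[C]_n) (tau : R) : 0 <= tau <= 1 ->
  phase_condition A B \/ gain_condition A B ->
  \det (1%:M + tau%:C *: (A *m B)) != 0.
Proof.
move=> /andP[t0 t1] AB; apply/negP => det0.
have {det0} : exists2 x : 'cV[C]_n, x != 0 & x + tau%:C *: (A *m (B *m x)) = 0.
  (* [det0P] yields a row vector in the left kernel, hence the transposition. *)
  rewrite -det_tr in det0.
  have /det0P[v v0] := det0.
  move=> /(congr1 trmx); rewrite trmx_mul trmxK trmx0 => h.
  exists v^T; first by rewrite -[0]trmx0 (inj_eq trmx_inj).
  by rewrite -[RHS]h mulmxDl mul1mx -scalemxAl mulmxA.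
move=> [x x0 /eqP]; rewrite addr_eq0 => /eqP xE.
have nx := x0; rewrite -vnorm_gt0 in nx.
have tau_gt0 : 0 < tau.
  rewrite lt_neqAle t0 andbT eq_sym; apply: contraNneq x0 => t0'.
  by rewrite xE t0' scale0r oppr0.
pose y := B *m x.
have AyE : A *m y = (- tau^-1)%:C *: x.
  rewrite xE scalerN -scaleNr scalerA -[- (_ : C)]rmorphN /= opprK.
  by rewrite -rmorphM /= mulVf ?gt_eqF// scale1r.
have Ay0 : A *m y != 0.
  by rewrite AyE scaler_eq0 negb_or x0 andbT -normc_eq0 normc_real normr_eq0
    oppr_eq0 invr_eq0 gt_eqF.
have y0 : y != 0 by apply: contra Ay0 => /eqP->; rewrite mulmx0.
case: AB => [|].
  rewrite /phase_condition ltNge => /negP; apply.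
  apply: le_trans (lerD (alpha_max_ub Ay0) (alpha_max_ub y0)).
  rewrite AyE -/y rdotZl vnormZ normrN gtr0_norm ?invr_gt0//.
  set c := rdot y x / (vnorm y * vnorm x).
  have -> : - tau^-1 * rdot x y / (tau^-1 * vnorm x * vnorm y) = - c.
    by rewrite /c (rdotC x); field; rewrite !gt_eqF ?vnorm_gt0.
  by rewrite acosN ?cos_angle_bounds// subrK.
rewrite /gain_condition ltNge => /negP; apply.
rewrite -(ler_pM2r nx) mul1r.
have -> : vnorm x = tau * vnorm (A *m y).
  by rewrite AyE vnormZ normrN gtr0_norm ?invr_gt0// mulrA mulfV ?gt_eqF// mul1r.
rewrite {1}AyE; apply: (@le_trans _ _ (vnorm (A *m y))).
  by rewrite -AyE ler_piMl ?vnorm_ge0.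
apply: le_trans (sigma_max_ub _ _) _.
rewrite -mulrA ler_wpM2l ?sigma_max_ge0//.
apply: le_trans (sigma_max_ub _ _) _; rewrite ler_wpM2l ?sigma_max_ge0//.
by rewrite AyE vnormZ normrN gtr0_norm ?invr_gt0// mulrA mulfV ?gt_eqF// mul1r.
Qed.

End GainPhase.

(** * Homotopy of Hurwitz polynomials *)

Section StablePolynomials.
Context {R : realType}.
Local Notation C := R[i].
Implicit Types (p q : {poly C}) (s : C).

Definition hurwitz p := forall s, 0 <= complex.Re s -> p.[s] != 0.

Lemma hurwitz_factor p : hurwitz p -> exists rs : seq C,
  [/\ p = lead_coef p *: \prod_(z <- rs) ('X - z%:P), size rs = (size p).-1 &
      all (fun r => complex.Re r < 0) rs].
Proof.
move=> hp; have [rs prs] := closed_field_poly_normal p.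
have p0 : p != 0 by apply/eqP => p0; have := hp 0 (lexx _); rewrite p0 horner0 eqxx.
exists rs; split=> //.
  by rewrite {1}prs size_scale ?lead_coef_eq0// size_prod_XsubC.
apply/allP => r rrs; rewrite ltNge; apply/negP => /hp/negP; apply.
rewrite prs hornerZ mulf_eq0; apply/orP; right.
by have := root_prod_XsubC rs r; rewrite rrs => /rootP ->.
Qed.

Lemma normc_horner_prod (rs : seq C) s :
  normc (\prod_(z <- rs) ('X - z%:P)).[s] = \prod_(z <- rs) normc (s - z).
Proof.
rewrite horner_prod normc_prod; apply: eq_bigr => z _.
by rewrite hornerXsubC.
Qed.

(** Each root satisfies [|s - r| >= Re s - Re r >= Re s]. The bound sees the polynomial only through
    its degree and leading coefficient, so it survives limits in which roots drift towards the
    axis. *)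
Lemma hurwitz_ge_Re p s : hurwitz p -> 0 <= complex.Re s ->
  normc (lead_coef p) * complex.Re s ^+ (size p).-1 <= normc p.[s].
Proof.
move=> /hurwitz_factor[rs [prs <- ars]] s0.
rewrite {2}prs hornerZ normcM ler_wpM2l ?normc_ge0// normc_horner_prod.
elim: rs ars {prs} => [|r rs IH /= /andP[r0 /IH{}IH]]; first by rewrite big_nil expr0.
rewrite big_cons exprS ler_pM// ?exprn_ge0//.
apply: le_trans (normc_geRe _); rewrite cReD cReN ger0_norm; lra.
Qed.

(** For a root [r], [1 + |s| <= |s - r| + (1 + |r|)] and [- Re r <= |s - r|], so [1 + |s|] is at
    most [1 + (1 + |r|) / (- Re r)] times [|s - r|]. The constant [c] collects the inverses of these
    numbers and the leading coefficient. *)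
Lemma hurwitz_lower_bound p : hurwitz p -> exists2 c : R, 0 < c &
  forall s, 0 <= complex.Re s -> c * (1 + normc s) ^+ (size p).-1 <= normc p.[s].
Proof.
move=> hp; have [rs [prs <- ars]] := hurwitz_factor hp.
have lc0 : 0 < normc (lead_coef p).
  rewrite normc_gt0 lead_coef_eq0; apply/eqP => p0.
  by have := hp 0 (lexx _); rewrite p0 horner0 eqxx.
suff [c c0 hc] : exists2 c : R, 0 < c & forall s, 0 <= complex.Re s ->
    c * (1 + normc s) ^+ size rs <= \prod_(z <- rs) normc (s - z).
  exists (normc (lead_coef p) * c); first by rewrite mulr_gt0.
  move=> s s0; rewrite {2}prs hornerZ normcM normc_horner_prod -mulrA.
  by rewrite ler_wpM2l ?normc_ge0// hc.
elim: rs ars {prs} => [_|r rs IH /= /andP[r0 /IH[c c0 hc]]].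
  by exists 1 => // s _; rewrite big_nil expr0 mulr1.
have k0 : 0 < 1 + (1 + normc r) / - complex.Re r.
  by rewrite ltr_wpDr// divr_ge0 ?addr_ge0 ?normc_ge0//; lra.
exists ((1 + (1 + normc r) / - complex.Re r)^-1 * c).
  by rewrite mulr_gt0// invr_gt0.
move=> s s0; rewrite big_cons exprS mulrACA.
have s1 : 0 <= 1 + normc s by rewrite addr_ge0 ?normc_ge0.
rewrite ler_pM ?hc// ?(mulr_ge0, invr_ge0, exprn_ge0, ltW k0, ltW c0)//.
rewrite mulrC ler_pdivrMr// mulrDr mulr1.
have h1 : - complex.Re r <= normc (s - r).
  by apply: le_trans (normc_geRe _); rewrite cReD cReN ger0_norm; lra.
have h2 : normc s <= normc (s - r) + normc r.
  by rewrite -{1}(subrK r s) normcD.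
apply: (@le_trans _ _ (normc (s - r) + (1 + normc r))); first lra.
rewrite lerD2l mulrA ler_pdivlMr; last by lra.
by rewrite mulrC ler_wpM2r// addr_ge0 ?normc_ge0.
Qed.

Definition coef_bound p : R := \sum_(i < size p) normc p`_i.

Lemma coef_bound_ge0 p : 0 <= coef_bound p.
Proof. by rewrite sumr_ge0// => i _; exact: normc_ge0. Qed.

Lemma normc_coef_le p i : normc p`_i <= coef_bound p.
Proof.
have [pi|ip] := leqP (size p) i; first by rewrite nth_default// normc0 coef_bound_ge0.
rewrite /coef_bound (bigD1 (Ordinal ip))//= lerDl sumr_ge0// => j _.
exact: normc_ge0.
Qed.

Lemma normc_horner_le p s N (K : R) : (size p <= N.+1)%N ->
  (forall i, normc p`_i <= K) ->
  normc p.[s] <= N.+1%:R * K * (1 + normc s) ^+ N.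
Proof.
move=> pN hK; have s1 : 1 <= 1 + normc s by rewrite lerDl normc_ge0.
rewrite (horner_coef_wide _ pN) (le_trans (normc_sum _ _ _))//.
rewrite -mulrA mulr_natl -[X in _ *+ X]card_ord -sumr_const ler_sum// => i _.
rewrite normcM normcX ler_pM ?exprn_ge0 ?normc_ge0//.
apply: (@le_trans _ _ ((1 + normc s) ^+ i)).
  by rewrite lerXn2r ?nnegrE ?addr_ge0 ?normc_ge0// lerDr.
by rewrite ler_weXn2l// -ltnS.
Qed.

(** The missing degree leaves a spare factor [1 + normc s], which becomes the rate of convergence in
    [ratio_near_infty]. *)
Lemma normc_horner_lt p s N : (size p <= N)%N ->
  normc p.[s] * (1 + normc s) <= N%:R * coef_bound p * (1 + normc s) ^+ N.
Proof.
case: N => [|N] pN.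
  by rewrite (eqP (_ : p == 0)) -?size_poly_leq0// horner0 normc0 !mul0r.
rewrite exprSr mulrA ler_wpM2r ?addr_ge0 ?normc_ge0//.
by apply: normc_horner_le => // i; exact: normc_coef_le.
Qed.

Section Homotopy.
Variables (P : R -> {poly C}) (N : nat) (K : R).
Hypothesis sizeP : forall t : R, 0 <= t <= 1 -> size (P t) = N.+1.
Hypothesis lipP : forall (t u : R) i, 0 <= t <= 1 -> 0 <= u <= 1 ->
  normc ((P t)`_i - (P u)`_i) <= K * `|t - u|.
Hypothesis axisP : forall (t : R) s, 0 <= t <= 1 -> complex.Re s = 0 -> (P t).[s] != 0.

Let K_ge0 : 0 <= K.
Proof.
have := @lipP 1 0 0%N; rewrite subr0 normr1 mulr1 => /(_ _ _)/(le_trans _); apply.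
- exact: normc_ge0.
- by rewrite ler01/=.
- by rewrite lexx/=.
Qed.

Let lip_horner t u s : 0 <= t <= 1 -> 0 <= u <= 1 ->
  normc ((P t).[s] - (P u).[s]) <= N.+1%:R * K * (1 + normc s) ^+ N * `|t - u|.
Proof.
move=> t01 u01; rewrite -hornerN -hornerD.
rewrite mulrAC -(mulrA _ K); apply: normc_horner_le.
  by rewrite (leq_trans (size_polyD _ _))// size_polyN !sizeP// maxnn.
by move=> i; rewrite coefB lipP.
Qed.

(** Moving the parameter changes the value at [s] by at most a multiple of [(1 + |s|)^N |t - u|],
    while [hurwitz_lower_bound] grows with the same power [N]; hence one radius serves for all
    [s]. *)
Let hurwitz_open t : 0 <= t <= 1 -> hurwitz (P t) ->
  exists2 d, 0 < d & forall u, 0 <= u <= 1 -> `|u - t| < d -> hurwitz (P u).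
Proof.
move=> t01 /hurwitz_lower_bound[c c0]; rewrite sizeP//= => hc.
have NK : 0 < N.+1%:R * K + 1 by rewrite ltr_wpDl// mulr_ge0.
(* The [+ 1] keeps the denominator positive when [K = 0]. *)
exists (c / (N.+1%:R * K + 1)); first by rewrite divr_gt0.
move=> u u01 ut s s0; apply/eqP => Pus.
have := hc s s0; apply/negP; rewrite -ltNge.
have := lip_horner s t01 u01; rewrite Pus subr0 => /le_lt_trans; apply.
have s1 : 0 < (1 + normc s) ^+ N by rewrite exprn_gt0// ltr_pwDl ?normc_ge0.
rewrite mulrAC ltr_pM2r// distrC.
apply: (@le_lt_trans _ _ ((N.+1%:R * K + 1) * `|u - t|)).
  by rewrite ler_wpM2r// lerDl.
by rewrite mulrC -ltr_pdivlMr.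
Qed.

(* A Hurwitz polynomial satisfies |p(s)| >= |lead_coef p| (Re s)^deg p, which
   passes to the limit along the family. *)
Let hurwitz_closed t : 0 <= t <= 1 ->
  (forall d, 0 < d -> exists u, [/\ 0 <= u <= 1, hurwitz (P u) & `|u - t| < d]) ->
  hurwitz (P t).
Proof.
move=> t01 ht s; rewrite le_eqVlt => /predU1P[/esym/axisP|s0]; first exact.
apply/eqP => Pts.
have lc0 : 0 < normc (P t)`_N.
  rewrite normc_gt0 -[N]/(N.+1.-1) -(sizeP t01) -/(lead_coef _) lead_coef_eq0.
  by rewrite -size_poly_gt0 sizeP.
pose a := N.+1%:R * K * (1 + normc s) ^+ N.
pose b := complex.Re s ^+ N.
have b0 : 0 < b by rewrite exprn_gt0.
have a0 : 0 <= a by rewrite !mulr_ge0 ?exprn_ge0 ?addr_ge0 ?normc_ge0.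
have abK : 0 < a + K * b + 1 by rewrite ltr_wpDl// addr_ge0// mulr_ge0 ?(ltW b0).
(* If [P t] vanished at [s], every Hurwitz [P u] would satisfy
   [|lead_coef (P t)| b <= (a + K b) |u - t|], by [h1] and [h2] below; the radius is chosen to
   contradict this. *)
have [|u [u01 hu]] := ht (normc (P t)`_N * b / (a + K * b + 1)).
  by rewrite !mulr_gt0// invr_gt0.
rewrite ltr_pdivlMr// ltNge => /negP; apply.
have h1 : normc (P u)`_N * b <= a * `|u - t|.
  apply: le_trans (lip_horner s u01 t01); rewrite Pts subr0.
  apply: le_trans (hurwitz_ge_Re hu (ltW s0)).
  by rewrite /lead_coef sizeP.
have h2 : normc (P t)`_N <= normc (P u)`_N + K * `|u - t|.
  rewrite addrC -lerBlDr (le_trans (normcB _ _))// distrC; exact: lipP.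
apply: (@le_trans _ _ ((normc (P u)`_N + K * `|u - t|) * b)).
  by rewrite ler_pM2r.
rewrite mulrDl; have := normr_ge0 (u - t); move: h1; nra.
Qed.

(** Connectedness of [0, 1] through a supremum: [E] contains [sup E] by closedness, and openness
    would exceed it if it were below 1. [E] is not known to be an interval, and only its supremum
    matters. *)
Lemma hurwitz_homotopy : hurwitz (P 0) -> hurwitz (P 1).
Proof.
move=> h0; pose E : set R := [set t | 0 <= t <= 1 /\ hurwitz (P t)]%classic.
have E0 : E 0 by split=> //; rewrite lexx ler01.
have supE : has_sup E by split; [exists 0|exists 1 => t [/andP[]]].
have t01 : 0 <= sup E <= 1.
  by rewrite sup_upper_bound//= ge_sup//; [exists 0|move=> t [/andP[]]].
have ht : hurwitz (P (sup E)).
  apply: hurwitz_closed => // d d0.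
  have [u [u01 hu] du] := sup_adherent d0 supE.
  exists u; split => //; rewrite distrC ger0_norm ?subr_ge0; first by lra.
  exact: sup_upper_bound.
have [d d0 hd] := hurwitz_open t01 ht.
have [e1|t1] := eqVneq (sup E) 1; first by rewrite -e1.
have {t1}t1 : sup E < 1 by rewrite lt_neqAle t1; case/andP: t01.
pose e := Num.min (d / 2) (1 - sup E).
have e0 : 0 < e by rewrite lt_min divr_gt0//= subr_gt0.
have ed : e <= d / 2 by rewrite ge_min lexx.
have e1 : e <= 1 - sup E by rewrite ge_min lexx orbT.
have /(sup_upper_bound supE) : E (sup E + e).
  have u01 : 0 <= sup E + e <= 1 by lra.
  by split=> //; apply: hd => //; rewrite addrAC subrr add0r gtr0_norm//; lra.
by move: e0; lra.
Qed.

End Homotopy.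

End StablePolynomials.

(** * Determinants of polynomial matrices *)

Section PolynomialMatrices.

(** [a] and [b] only bound the degrees, so that factors whose degree is smaller, such as numerators
    of strictly proper entries, are covered. *)
Lemma coefM_top (K : nzRingType) (p q : {poly K}) a b :
  (size p <= a.+1)%N -> (size q <= b.+1)%N -> (p * q)`_(a + b) = p`_a * q`_b.
Proof.
move=> pa qb; have ab : (a < (a + b).+1)%N by rewrite ltnS leq_addr.
rewrite coefM (bigD1 (Ordinal ab))//= addKn big1 ?addr0// => i.
rewrite -(inj_eq val_inj) /= => ia.
have [ai|ia'] := ltnP a i; first by rewrite nth_default ?mul0r// (leq_trans pa).
rewrite [q`__]nth_default ?mulr0// (leq_trans qb)//.
by rewrite ltn_subRL ltn_add2r ltn_neqAle ia ia'.
Qed.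

Lemma size_coef_prod_top (K : comNzRingType) n (p : 'I_n -> {poly K}) m :
  (forall i, (size (p i) <= m.+1)%N) ->
  (size (\prod_i p i)%R <= (n * m).+1)%N /\ (\prod_i p i)`_(n * m) = \prod_i (p i)`_m.
Proof.
elim: n p => [|n IH] p pm.
  by rewrite !big_ord0 mul0n coefC eqxx size_poly1.
have [IH1 IH2] := IH _ (fun i => pm (lift ord0 i)).
rewrite !big_ord_recl mulSn; split; last by rewrite coefM_top// IH2.
apply: leq_trans (size_polyMleq _ _) _.
by rewrite -[X in (_ <= X)%N]/((m + n * m).+2.-1) -addSn -addnS;
  case: (_ + _)%N (leq_add (pm ord0) IH1).
Qed.

(** By the Leibniz formula. The matrix of coefficients of degree [m] is the limit of [A(s) / s^m] at
    infinity; this is how the values at infinity control the degree of the determinant. *)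
Lemma size_coef_det_top (K : comNzRingType) n (A : 'M[{poly K}]_n) m :
  (forall i j, (size (A i j) <= m.+1)%N) ->
  (size (\det A) <= (n * m).+1)%N /\
  (\det A)`_(n * m) = \det (map_mx (coefp m) A).
Proof.
move=> Am; have h (s : 'S_n) := size_coef_prod_top (fun i => Am i (s i)).
split.
  apply: leq_trans (size_sum _ _ _) _; apply/bigmax_leqP => s _.
  by case: (odd_perm s); rewrite ?expr1 ?expr0 ?mulN1r ?mul1r ?size_polyN; case: (h s).
rewrite coef_sum; apply: eq_bigr => s _.
have -> : \prod_i (map_mx (coefp m) A) i (s i) = \prod_i (A i (s i))`_m.
  by apply: eq_bigr => i _; rewrite mxE.
case: (h s) => _ <-.
by case: (odd_perm s); rewrite ?expr1 ?expr0 ?mulN1r ?mul1r ?coefN.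
Qed.

Lemma det_coef_lipschitz (R : realType) n (A B : 'M[{poly R[i]}]_n) :
  exists K : R, forall (t u : R) i, 0 <= t <= 1 -> 0 <= u <= 1 ->
  normc ((\det (A + (t%:C)%:P *: B))`_i - (\det (A + (u%:C)%:P *: B))`_i)
    <= K * `|t - u|.
Proof.
(* The determinant as a polynomial in the parameter, with coefficients in C[X]. *)
pose Q := \det (map_mx polyC A + 'X *: map_mx polyC B).
have QE t : \det (A + t%:P *: B) = Q.[t%:P].
  rewrite -horner_evalE -det_map_mx; congr (\det _).
  apply/matrixP => i j; rewrite !mxE /= /horner_eval.
  by rewrite hornerD hornerM !hornerC hornerX.
have QiE t i : (\det (A + t%:P *: B))`_i = \sum_(k < size Q) Q`_k`_i * t ^+ k.
  rewrite QE horner_coef coef_sum; apply: eq_bigr => k _.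
  by rewrite -rmorphXn coefMC.
(* The power [t^k] is [k]-Lipschitz on [0, 1], and [coef_bound] dominates all coefficients at once,
   so that the constant does not depend on [i]. *)
exists (\sum_(k < size Q) coef_bound Q`_k * k%:R) => t u i /andP[t0 t1] /andP[u0 u1].
rewrite !QiE -sumrB (le_trans (normc_sum _ _ _))// mulr_suml ler_sum// => k _.
rewrite -mulrBr normcM -mulrA ler_pM ?normc_ge0 ?normc_coef_le//.
rewrite -!rmorphXn -rmorphB normc_real.
elim: (k : nat) => [|m IH]; first by rewrite !expr0 subrr normr0 mul0r.
rewrite !exprS.
have -> : t * t ^+ m - u * u ^+ m = t * (t ^+ m - u ^+ m) + u ^+ m * (t - u) by ring.
apply: le_trans (ler_normD _ _) _; rewrite !normrM -natr1 mulrDl mul1r lerD//.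
  by apply: le_trans IH; rewrite ler_piMl// ger0_norm.
by rewrite ler_piMl// ger0_norm ?exprn_ge0// exprn_ile1.
Qed.

End PolynomialMatrices.

(** * Rational transfer matrices *)

Section RationalMatrices.
Context {R : realType}.
Local Notation C := R[i].
Implicit Types (p q D : {poly C}) (s : C).

Definition heval s n (N : 'M[{poly C}]_n) : 'M[C]_n := map_mx (horner_eval s) N.

Lemma hurwitz_neq0 p : hurwitz p -> p != 0.
Proof.
by move=> hp; apply/eqP => p0; have := hp 0 (lexx _); rewrite p0 horner0 eqxx.
Qed.

Lemma size_mul_leS (K : nzRingType) (p q : {poly K}) a b :
  (size p <= a.+1)%N -> (size q <= b.+1)%N -> (size (p * q)%R <= (a + b).+1)%N.
Proof.
move=> pa qb; apply: leq_trans (size_polyMleq _ _) _.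
by have := leq_add pa qb; rewrite addSn addnS; case: (_ + _)%N.
Qed.

Lemma ceval_conj (p : {poly R}) s : ceval p s^* = (ceval p s)^*.
Proof.
rewrite /ceval -horner_map; congr horner.
by rewrite -map_poly_comp; apply: eq_map_poly => x /=; rewrite oppr0.
Qed.

(** The coefficients are real. This symmetry supplies the negative frequencies, about which nothing
    is assumed, and later the real responses to real inputs. *)
Lemma RHoo_conj n (H : C -> 'M[C]_n) : RHoo H ->
  forall s, 0 <= complex.Re s -> H s^* = map_mx conjc (H s).
Proof.
move=> hH s s0; apply/matrixP => i j; rewrite !mxE.
have [p [q [_ _ h]]] := hH i j.
by rewrite !h ?cReJ// !ceval_conj rmorphM fmorphV.
Qed.

(** The product of the denominators of all entries serves. Numerator and denominator of an entry are
    multiplied by the same [E i j], which preserves properness. The coefficients move to C, where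
    [D] splits into linear factors. *)
Lemma RHoo_common_denominator n (H : C -> 'M[C]_n) : RHoo H ->
  exists D (N : 'M[{poly C}]_n),
    [/\ hurwitz D, forall i j, (size (N i j) <= size D)%N &
        forall s, 0 <= complex.Re s -> H s = D.[s]^-1 *: heval s N].
Proof.
move=> hH.
have /choice[f hf] : forall ij : 'I_n * 'I_n, exists pq : {poly R} * {poly R},
    [/\ (size pq.1 <= size pq.2)%N,
        (forall s, 0 <= complex.Re s -> ceval pq.2 s != 0) &
        (forall s, 0 <= complex.Re s ->
           H s ij.1 ij.2 = ceval pq.1 s / ceval pq.2 s)].
  by move=> [i j]; have [p [q h]] := hH i j; exists (p, q).
pose toC : {poly R} -> {poly C} := map_poly (real_complex R).
pose D := \prod_ij toC (f ij).2.
pose E i j := \prod_(kl | kl != (i, j)) toC (f kl).2.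
have hE i j : hurwitz (E i j).
  move=> s s0; rewrite horner_prod; apply/prodf_neq0 => kl _.
  by have [_ h _] := hf kl; exact: h.
have DE i j : D = toC (f (i, j)).2 * E i j by rewrite /D (bigD1 (i, j)).
exists D, (\matrix_(i, j) (toC (f (i, j)).1 * E i j)); split.
- move=> s s0; rewrite horner_prod; apply/prodf_neq0 => kl _.
  by have [_ h _] := hf kl; exact: h.
- move=> i j; rewrite mxE (DE i j); have [le12 h _] := hf (i, j).
  have hq : toC (f (i, j)).2 != 0 by apply: hurwitz_neq0 => s; exact: h.
  rewrite (size_mul hq (hurwitz_neq0 (hE i j))) (leq_trans (size_polyMleq _ _))//.
  by rewrite -!subn1 leq_sub2r// leq_add2r !size_map_poly.
- move=> s s0; apply/matrixP => i j; rewrite !mxE /horner_eval (DE i j) !hornerM.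
  have [_ h ->]// := hf (i, j).
  rewrite /ceval -/(toC _) -/(toC _); field.
  by rewrite hE//; exact: h.
Qed.

Lemma cvgy_le_inv (f : R -> R) (l M : R) :
  (forall w, 0 <= w -> `|f w - l| * (1 + w) <= M) -> (f w @[w --> +oo%R] --> l)%classic.
Proof.
move=> hf; apply/cvgrPdist_lt => e e0.
have M0 : 0 <= M by apply: le_trans (hf 0 _); rewrite ?mulr_ge0 ?addr_ge0.
near=> w.
have w0 : 0 <= w by near: w; exact: nbhs_pinfty_ge.
have wM : M / e < 1 + w.
  rewrite -ltrBlDl; near: w; apply: nbhs_pinfty_gt; exact: num_real.
rewrite distrC -(@ltr_pM2r _ (1 + w)) ?ltr_pwDl//.
apply: le_lt_trans (hf _ w0) _; by rewrite mulrC -ltr_pdivrMr.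
Unshelve. all: by end_near. Qed.

Lemma normc_jw (w : R) : normc (jw w) = `|w|.
Proof. by rewrite /= expr0n add0r sqrtr_sqr. Qed.

Lemma ratio_near_infty p D : hurwitz D -> (size p <= size D)%N ->
  exists M : R, forall w, 0 <= w ->
   normc (p.[jw w] / D.[jw w] - p`_(size D).-1 / lead_coef D) * (1 + w) <= M.
Proof.
move=> hD pD; set d := (size D).-1.
have D0 := hurwitz_neq0 hD.
have sD : size D = d.+1 by rewrite prednK// size_poly_gt0.
have [c c0 hc] := hurwitz_lower_bound hD.
(* The coefficients of degree [d] cancel, so the remainder [r] divided by [D] decays like
   [1 / (1 + w)]. *)
pose r := lead_coef D *: p - p`_d *: D.
have rd : (size r <= d)%N.
  apply/leq_sizeP => j; rewrite leq_eqVlt coefB !coefZ => /predU1P[<-|dj].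
    by rewrite mulrC subrr.
  by rewrite [p`_j]nth_default ?[D`_j]nth_default ?mulr0 ?subr0 ?(leq_trans pD) ?sD.
have lc0 : 0 < normc (lead_coef D) by rewrite normc_gt0 lead_coef_eq0.
exists (d%:R * coef_bound r / c / normc (lead_coef D)) => w w0.
have jw0 : 0 <= complex.Re (jw w) by [].
have -> : p.[jw w] / D.[jw w] - p`_d / lead_coef D =
    r.[jw w] / (D.[jw w] * lead_coef D).
  rewrite hornerD hornerN !hornerZ; field.
  by rewrite hD// lead_coef_eq0 D0.
rewrite normcM normcV normcM invfM mulrA -mulrA [_^-1 * _]mulrC mulrA.
rewrite ler_pM2r ?invr_gt0// mulrAC.
have Dj : 0 < normc D.[jw w] by rewrite normc_gt0 hD.
rewrite ler_pdivrMr//.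
have := normc_horner_lt (jw w) rd; rewrite normc_jw ger0_norm// => /le_trans; apply.
rewrite -[leRHS]mulrA ler_wpM2l ?mulr_ge0 ?coef_bound_ge0//.
by rewrite mulrC ler_pdivlMr// mulrC; have := hc _ jw0; rewrite normc_jw ger0_norm.
Qed.

(** The convergence given by [ratio_near_infty] lends meaning to the [lim] in [at_infty]. The value
    is written with coefficients so that it can be matched with the top coefficient of the
    determinant. *)
Lemma at_inftyE n (H : C -> 'M[C]_n) D (N : 'M[{poly C}]_n) : hurwitz D ->
  (forall i j, (size (N i j) <= size D)%N) ->
  (forall s, 0 <= complex.Re s -> H s = D.[s]^-1 *: heval s N) ->
  at_infty H = (lead_coef D)^-1 *: map_mx (coefp (size D).-1) N.
Proof.
move=> hD sN HE; apply/matrixP => i j; rewrite !mxE.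
have [M hM] := ratio_near_infty hD (sN i j).
have HjE w : H (jw w) i j = (N i j).[jw w] / D.[jw w].
  by rewrite HE//= !mxE mulrC.
rewrite [RHS]mulrC; apply: complexP; apply: cvg_lim => //;
  apply: (@cvgy_le_inv _ _ M) => w w0; apply: le_trans (hM w w0);
  rewrite ler_wpM2r ?addr_ge0// HjE.
  by rewrite -cReN -cReD normc_geRe.
by rewrite -cImN -cImD normc_geIm.
Qed.

End RationalMatrices.

(** * The closed-loop transfer matrix is proper and stable *)

Section ClosedLoopRational.
Context {R : realType} {n : nat}.
Local Notation C := R[i].
Variables H1 H2 : C -> 'M[C]_n.
Hypotheses (hH1 : RHoo H1) (hH2 : RHoo H2).
Hypothesis hfreq : forall w : R, 0 <= w ->
  phase_condition (H1 (jw w)) (H2 (jw w)) \/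
  gain_condition (H1 (jw w)) (H2 (jw w)).
Hypothesis hinfty :
  phase_condition (at_infty H1) (at_infty H2) \/
  gain_condition (at_infty H1) (at_infty H2).

(** At a negative frequency the determinant is the conjugate of the one at [s^*], since [t] is real
    and both matrices are symmetric under conjugation. *)
Lemma axis_nonsingular (t : R) s : 0 <= t <= 1 -> complex.Re s = 0 ->
  \det (1%:M + t%:C *: (H1 s *m H2 s)) != 0.
Proof.
move=> t01 s0.
have [w0|w0] := leP 0 (complex.Im s).
  have -> : s = jw (complex.Im s) by apply: complexP.
  exact: (phase_gain_nonsingular t01 (hfreq w0)).
have s'E : s^* = jw (- complex.Im s) by apply: complexP; rewrite ?cReJ ?cImJ.
have w0' : 0 <= - complex.Im s by rewrite oppr_ge0 ltW.
have h := phase_gain_nonsingular t01 (hfreq w0').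
rewrite -s'E in h; apply: contraNneq h => h.
have s0' : 0 <= complex.Re s by rewrite s0.
rewrite (RHoo_conj hH1 s0') (RHoo_conj hH2 s0').
have -> : 1%:M + t%:C *: (map_mx conjc (H1 s) *m map_mx conjc (H2 s)) =
    map_mx conjc (1%:M + t%:C *: (H1 s *m H2 s)).
  rewrite map_mxD map_mx1 map_mxZ map_mxM; congr (_ + _ *: _).
  exact/esym/conjc_real.
by rewrite det_map_mx h rmorph0.
Qed.

(** [A t] is [1 + t H1 H2] with denominators cleared, so [P t = (D1 D2)^n det (1 + t H1 H2)], and
    [P 0 = (D1 D2)^n] is Hurwitz. At [t = 1] the adjugate writes the inverse as a fraction over
    [P 1]. *)
Lemma closed_loop_rational : exists D (N : 'M[{poly C}]_n),
  [/\ hurwitz D, forall i j, (size (N i j) <= size D)%N &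
      forall s, 0 <= complex.Re s ->
        \det (1%:M + H1 s *m H2 s) != 0 /\
        invmx (1%:M + H1 s *m H2 s) *m H1 s = D.[s]^-1 *: heval s N].
Proof.
have [D1 [N1 [hD1 sN1 H1E]]] := RHoo_common_denominator hH1.
have [D2 [N2 [hD2 sN2 H2E]]] := RHoo_common_denominator hH2.
set d1 := (size D1).-1; set d2 := (size D2).-1.
have sD1 : size D1 = d1.+1 by rewrite prednK// size_poly_gt0 hurwitz_neq0.
have sD2 : size D2 = d2.+1 by rewrite prednK// size_poly_gt0 hurwitz_neq0.
pose A (t : R) := (D1 * D2)%:M + t%:C%:P *: (N1 *m N2).
pose P t := \det (A t).
have sA t i j : (size (A t i j) <= (d1 + d2).+1)%N.
  rewrite !mxE (leq_trans (size_polyD _ _))// geq_max; apply/andP; split.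
    by case: eqP => _; rewrite ?size_poly0// size_mul_leS ?sD1 ?sD2.
  rewrite mul_polyC (leq_trans (size_scale_leq _ _))//.
  rewrite (leq_trans (size_sum _ _ _))//; apply/bigmax_leqP => k _.
  by rewrite size_mul_leS// -?sD1 -?sD2.
have evalA t s : 0 <= complex.Re s -> heval s (A t) =
    (D1.[s] * D2.[s]) *: (1%:M + t%:C *: (H1 s *m H2 s)).
  move=> s0; rewrite /heval /A map_mxD map_mxZ map_mxM map_scalar_mx /=.
  rewrite /horner_eval hornerM hornerC H1E// H2E// -scalemxAl -scalemxAr.
  rewrite scalerDr !scalerA scalemx1; congr (_ + _ *: _).
  by field; rewrite hD1// hD2.
have PE t s : 0 <= complex.Re s -> (P t).[s] =
    (D1.[s] * D2.[s]) ^+ n * \det (1%:M + t%:C *: (H1 s *m H2 s)).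
  by move=> s0; rewrite -detZ -evalA// /heval det_map_mx.
(* This is where the condition at infinity enters: the top coefficient is a nonzero multiple of
   [det (1 + t H1(oo) H2(oo))], so the degree of [P t] is the same for all [t]. *)
have topP t : 0 <= t <= 1 -> (P t)`_(n * (d1 + d2)) != 0.
  move=> t01; have [_ ->] := size_coef_det_top (sA t).
  have -> : map_mx (coefp (d1 + d2)) (A t) = (lead_coef D1 * lead_coef D2) *:
      (1%:M + t%:C *: (at_infty H1 *m at_infty H2)).
    rewrite (at_inftyE hD1 sN1 H1E) (at_inftyE hD2 sN2 H2E).
    rewrite -scalemxAl -scalemxAr scalerDr !scalerA scalemx1.
    apply/matrixP => i j; rewrite !mxE /= /coefp coefD; congr (_ + _).
      by case: eqP => _; rewrite ?coef0// ?mulr1n coefM_top ?sD1 ?sD2.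
    rewrite mul_polyC coefZ coef_sum.
    have -> : lead_coef D1 * lead_coef D2 * (t%:C / lead_coef D1) / lead_coef D2 =
        t%:C by field; rewrite !lead_coef_eq0 !hurwitz_neq0.
    congr (_ * _); apply: eq_bigr => k _.
    by rewrite coefM_top ?mxE//= -?sD1 -?sD2.
  rewrite detZ mulf_neq0 ?(phase_gain_nonsingular t01 hinfty)//.
  by rewrite expf_neq0// mulf_neq0// lead_coef_eq0 hurwitz_neq0.
have sP t : 0 <= t <= 1 -> size (P t) = (n * (d1 + d2)).+1.
  move=> t01; apply/eqP; rewrite eqn_leq; have [-> _] := size_coef_det_top (sA t).
  by rewrite ltnNge; apply: contra (topP t t01) => /leq_sizeP ->.
have [K hK] := det_coef_lipschitz (D1 * D2)%:M (N1 *m N2).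
have hP1 : hurwitz (P 1).
  apply: (hurwitz_homotopy sP hK).
    move=> t s t01 s0; rewrite PE ?s0// mulf_neq0 ?axis_nonsingular//.
    by rewrite expf_neq0// mulf_neq0 ?hD1 ?hD2 ?s0.
  move=> s s0; rewrite PE// scale0r addr0 det1 mulr1.
  by rewrite expf_neq0// mulf_neq0 ?hD1 ?hD2.
(* From [(1 + H1 H2)^-1 = D1 D2 adj (A 1) / P 1] and [H1 = N1 / D1], where [D1] cancels. *)
exists (P 1), (D2 *: (\adj (A 1) *m N1)); split=> //.
  move=> i j; rewrite sP ?ler01 ?lexx// mxE mxE.
  have n0 : (0 < n)%N by case: (n) i => [[]|].
  (* Degree count for properness: [D2] contributes [d2], a cofactor at most [(n - 1) (d1 + d2)], and
     an entry of [N1] at most [d1]. *)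
  have -> : (n * (d1 + d2) = d2 + (n.-1 * (d1 + d2) + d1))%N.
    by rewrite -{1}(prednK n0) mulSn; lia.
  apply: size_mul_leS; first by rewrite sD2.
  rewrite (leq_trans (size_sum _ _ _))//; apply/bigmax_leqP => k _.
  apply: size_mul_leS; last by rewrite -sD1.
  rewrite mxE /cofactor -signr_odd.
  have sA' a b : (size (row' k (col' i (A 1%R)) a b) <= (d1 + d2).+1)%N.
    by rewrite mxE mxE sA.
  have [h _] := size_coef_det_top sA'.
  by case: (odd _); rewrite ?expr1 ?expr0 ?mulN1r ?mul1r ?size_polyN.
move=> s s0.
have dP := hP1 s s0.
have d0 : \det (1%:M + H1 s *m H2 s) != 0.
  by move: dP; rewrite PE// mulf_eq0 negb_or scale1r => /andP[].
split => //.
have u : 1%:M + H1 s *m H2 s \in unitmx by rewrite unitmxE unitfE.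
apply: (can_inj (mulKmx u)); rewrite mulKVmx//.
have e1 := evalA 1 s s0; rewrite scale1r in e1.
have DD : D1.[s] * D2.[s] != 0 by rewrite mulf_neq0 ?hD1 ?hD2.
have -> : 1%:M + H1 s *m H2 s = (D1.[s] * D2.[s])^-1 *: heval s (A 1).
  by rewrite e1 scalerA mulVf// scale1r.
have adjE : heval s (A 1) *m heval s (\adj (A 1)) = (P 1).[s]%:M.
  by rewrite /heval -map_mxM mul_mx_adj map_scalar_mx.
have -> : heval s (D2 *: (\adj (A 1) *m N1)) =
    D2.[s] *: (heval s (\adj (A 1)) *m heval s N1).
  by rewrite /heval map_mxZ map_mxM.
rewrite -!scalemxAr -!scalemxAl mulmxA adjE mul_scalar_mx !scalerA H1E//.
by congr (_ *: _); field; rewrite dP hD1// hD2.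
Qed.

End ClosedLoopRational.

(** * Complex-valued integrals *)

Section ComplexExponential.
Context {R : realType}.
Local Notation C := R[i].
Implicit Types z w : C.

Lemma cexpD z w : cexp (z + w) = cexp z * cexp w.
Proof.
by apply: complexP; rewrite ?cReM ?cImM /= cReD cImD expRD ?cosD ?sinD; ring.
Qed.

Lemma cexp0 : cexp (0 : C) = 1.
Proof. by rewrite /cexp /= expR0 cos0 sin0 mulr0 mulr1. Qed.

Lemma cexpN_mul z : cexp (- z) * cexp z = 1.
Proof. by rewrite -cexpD addNr cexp0. Qed.

Lemma normc_cexp z : normc (cexp z) = expR (complex.Re z).
Proof.
rewrite normcE2 /= !exprMn -mulrDr cos2Dsin2 mulr1 sqrtr_sqr.
by rewrite ger0_norm ?expR_ge0.
Qed.

Lemma cexpJ z : cexp z^* = (cexp z)^*.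
Proof. by apply: complexP; rewrite ?cReJ ?cImJ /= cReJ cImJ ?cosN ?sinN ?mulrN. Qed.

Lemma cexp_real (x : R) : cexp x%:C = (expR x)%:C.
Proof. by apply: complexP; rewrite /= ?cos0 ?sin0 ?mulr1 ?mulr0. Qed.

End ComplexExponential.

Section ComplexMeasurable.
Local Open Scope classical_set_scope.
Context {R : realType} d (T : measurableType d).
Local Notation C := R[i].
Implicit Types (D : set T) (f g : T -> C) (h : T -> R).

Definition cmeasurable D f :=
  measurable_fun D (fun x => complex.Re (f x)) /\
  measurable_fun D (fun x => complex.Im (f x)).

Lemma cmeasurableD D f g : cmeasurable D f -> cmeasurable D g ->
  cmeasurable D (fun x => f x + g x).
Proof.
move=> [f1 f2] [g1 g2]; split.
  by under eq_fun do rewrite cReD; exact: measurable_funD.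
by under eq_fun do rewrite cImD; exact: measurable_funD.
Qed.

Lemma cmeasurableN D f : cmeasurable D f -> cmeasurable D (fun x => - f x).
Proof.
move=> [f1 f2]; split.
  by under eq_fun do rewrite cReN; exact: measurable_funN.
by under eq_fun do rewrite cImN; exact: measurable_funN.
Qed.

Lemma cmeasurableM D f g : cmeasurable D f -> cmeasurable D g ->
  cmeasurable D (fun x => f x * g x).
Proof.
move=> [f1 f2] [g1 g2]; split.
  by under eq_fun do rewrite cReM; apply: measurable_funB; exact: measurable_funM.
by under eq_fun do rewrite cImM; apply: measurable_funD; exact: measurable_funM.
Qed.

Lemma cmeasurable_cst D (c : C) : cmeasurable D (fun=> c).
Proof. by split; exact: measurable_cst. Qed.

Lemma cmeasurable_real D h : measurable_fun D h -> cmeasurable D (fun x => (h x)%:C).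
Proof. by move=> mh; split=> //; exact: measurable_cst. Qed.

Lemma cmeasurable_cexp D f : cmeasurable D f -> cmeasurable D (fun x => cexp (f x)).
Proof.
move=> [f1 f2].
have me : measurable_fun D (fun x => expR (complex.Re (f x))).
  exact: measurableT_comp f1.
by split; apply: measurable_funM => //; apply: measurableT_comp f2;
  apply: continuous_measurable_fun; [exact: continuous_cos|exact: continuous_sin].
Qed.

Lemma measurable_normc D f : cmeasurable D f -> measurable_fun D (fun x => normc (f x)).
Proof.
move=> [f1 f2]; under eq_fun do rewrite normcE2.
apply: (measurableT_comp (continuous_measurable_fun (@sqrt_continuous R))).
by apply: measurable_funD; exact: measurable_funX.
Qed.

Lemma eq_cmeasurable D f g : {in D, f =1 g} -> cmeasurable D f -> cmeasurable D g.
Proof.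
by move=> fg [f1 f2]; split; [apply: eq_measurable_fun f1|apply: eq_measurable_fun f2];
  move=> x xD; rewrite fg.
Qed.

(** Extension by zero, so that Fubini can be applied on full product spaces. *)
Definition crestrict D f : T -> C := fun x => if x \in D then f x else 0.

Lemma cmeasurable_restrict D f : measurable D ->
  cmeasurable D f -> cmeasurable setT (crestrict D f).
Proof.
move=> mD [f1 f2]; split.
  have /(measurable_restrictT _ mD) := f1; apply: eq_measurable_fun => x _.
  by rewrite /patch /crestrict; case: ifP.
have /(measurable_restrictT _ mD) := f2; apply: eq_measurable_fun => x _.
by rewrite /patch /crestrict; case: ifP.
Qed.

End ComplexMeasurable.

Lemma cmeasurable_comp {R : realType} d d' (T : measurableType d)
    (T' : measurableType d') (f : T' -> R[i]) (g : T -> T') :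
  cmeasurable setT f -> measurable_fun setT g -> cmeasurable setT (f \o g).
Proof.
move=> [f1 f2] mg.
by split; [exact: measurableT_comp f1 mg|exact: measurableT_comp f2 mg].
Qed.

Lemma cmeasurable_if {R : realType} d (T : measurableType d) (b : T -> bool)
    (f : T -> R[i]) : measurable_fun setT b -> cmeasurable setT f ->
  cmeasurable setT (fun x => if b x then f x else 0).
Proof.
move=> mb [f1 f2]; split.
  apply: eq_measurable_fun (measurable_fun_ifT mb f1 (measurable_cst (0 : R))) => x _.
  by case: ifP.
apply: eq_measurable_fun (measurable_fun_ifT mb f2 (measurable_cst (0 : R))) => x _.
by case: ifP.
Qed.

Section ComplexIntegral.
Local Open Scope classical_set_scope.
Context {R : realType} d (T : measurableType d).
Local Notation C := R[i].
Variable mu : {measure set T -> \bar R}.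
Implicit Types (D : set T) (f g : T -> C) (h : T -> R).

Definition cintegrable D f :=
  mu.-integrable D (fun x => (complex.Re (f x))%:E) /\
  mu.-integrable D (fun x => (complex.Im (f x))%:E).

Definition cint D f : C :=
  (\int[mu]_(x in D) complex.Re (f x)) +i* (\int[mu]_(x in D) complex.Im (f x)).

Lemma cintegrable_measurable D f : cintegrable D f -> cmeasurable D f.
Proof. by move=> [/measurable_int/measurable_EFinP ? /measurable_int/measurable_EFinP]. Qed.

Lemma cintegrable_le D f h : measurable D -> cmeasurable D f ->
  mu.-integrable D (EFin \o h) -> (forall x, D x -> normc (f x) <= h x) ->
  cintegrable D f.
Proof.
move=> mD [f1 f2] ih fh; split; apply: le_integrable ih => //.
- exact/measurable_EFinP.
- move=> x Dx /=; rewrite lee_fin (le_trans (normc_geRe _))//.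
  by rewrite (le_trans (fh _ Dx))// ler_norm.
- exact/measurable_EFinP.
- move=> x Dx /=; rewrite lee_fin (le_trans (normc_geIm _))//.
  by rewrite (le_trans (fh _ Dx))// ler_norm.
Qed.

Lemma cintegrable_normc D f : measurable D -> cintegrable D f ->
  mu.-integrable D (fun x => (normc (f x))%:E).
Proof.
move=> mD fi; have [f1 f2] := fi.
apply: le_integrable (integrableD mD (integrable_abse f1) (integrable_abse f2)) => //.
  exact/measurable_EFinP/measurable_normc/cintegrable_measurable.
move=> x Dx /=; rewrite lee_fin ger0_norm ?normc_ge0//.
by rewrite ger0_norm ?addr_ge0// normc_leD.
Qed.

Lemma eq_cintegrable D f g : measurable D -> {in D, f =1 g} ->
  cintegrable D f -> cintegrable D g.
Proof.
by move=> mD fg [f1 f2]; split; [apply: eq_integrable f1|apply: eq_integrable f2] => //;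
  move=> x xD; rewrite fg.
Qed.

Lemma eq_cint D f g : {in D, f =1 g} -> cint D f = cint D g.
Proof. by move=> fg; congr Complex; apply: eq_Rintegral => x xD; rewrite fg. Qed.

Lemma cintegrableD D f g : measurable D -> cintegrable D f -> cintegrable D g ->
  cintegrable D (fun x => f x + g x).
Proof.
move=> mD [f1 f2] [g1 g2]; split.
  by apply: eq_integrable (integrableD mD f1 g1) => // x _; rewrite cReD.
by apply: eq_integrable (integrableD mD f2 g2) => // x _; rewrite cImD.
Qed.

Lemma cintegrableZ D f (c : C) : measurable D -> cintegrable D f ->
  cintegrable D (fun x => c * f x).
Proof.
move=> mD [f1 f2]; split.
  apply: eq_integrable (integrableB mD (integrableZl mD (complex.Re c) f1)
    (integrableZl mD (complex.Im c) f2)) => // x _.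
  by rewrite cReM.
apply: eq_integrable (integrableD mD (integrableZl mD (complex.Re c) f2)
    (integrableZl mD (complex.Im c) f1)) => // x _.
by rewrite cImM.
Qed.

Lemma cintD D f g : measurable D -> cintegrable D f -> cintegrable D g ->
  cint D (fun x => f x + g x) = cint D f + cint D g.
Proof.
move=> mD [f1 f2] [g1 g2]; apply: complexP; rewrite ?cReD ?cImD /= -RintegralD//;
  by apply: eq_Rintegral => x _; rewrite ?cReD ?cImD.
Qed.

Lemma cintZ D f (c : C) : measurable D -> cintegrable D f ->
  cint D (fun x => c * f x) = c * cint D f.
Proof.
move=> mD [f1 f2].
have rr := integrableZl mD (complex.Re c) f1.
have ii := integrableZl mD (complex.Im c) f2.
have ri := integrableZl mD (complex.Re c) f2.
have ir := integrableZl mD (complex.Im c) f1.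
apply: complexP; rewrite ?cReM ?cImM /= -!RintegralZl//.
  rewrite -RintegralB//.
  by apply: eq_Rintegral => x _; rewrite cReM.
rewrite -RintegralD//.
by apply: eq_Rintegral => x _; rewrite cImM.
Qed.

Lemma cintJ D f : measurable D -> cintegrable D f ->
  cint D (fun x => (f x)^*) = (cint D f)^*.
Proof.
move=> mD [f1 f2]; apply: complexP; rewrite ?cReJ ?cImJ /=.
  by apply: eq_Rintegral => x _; rewrite cReJ.
rewrite -mulN1r -RintegralZl//.
by apply: eq_Rintegral => x _; rewrite cImJ mulN1r.
Qed.

Lemma cint0 D : cint D (fun=> 0) = 0.
Proof. by apply: complexP; rewrite /= /Rintegral integral0. Qed.

Lemma cint_restrict D f : cint D f = cint setT (crestrict D f).
Proof.
by apply: complexP; rewrite /= Rintegral_mkcond; apply: eq_Rintegral => x _;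
  rewrite /patch /crestrict; case: ifP.
Qed.

Lemma cintegrable_restrict D f : measurable D ->
  cintegrable D f <-> cintegrable setT (crestrict D f).
Proof.
move=> mD; split=> -[f1 f2]; split.
- move/(integrable_mkcond _ mD): f1; apply: eq_integrable => // x _.
  by rewrite /patch /crestrict; case: ifP.
- move/(integrable_mkcond _ mD): f2; apply: eq_integrable => // x _.
  by rewrite /patch /crestrict; case: ifP.
- apply/(integrable_mkcond _ mD); apply: eq_integrable f1 => // x _.
  by rewrite /patch /crestrict; case: ifP.
- apply/(integrable_mkcond _ mD); apply: eq_integrable f2 => // x _.
  by rewrite /patch /crestrict; case: ifP.
Qed.

(** If the integral is [z], multiplying [f] by the unit number [z^* / |z|] makes the integral equal
    to [|z|]; it then suffices to integrate [Re <= |.|]. *)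
Lemma normc_cint D f : measurable D -> cintegrable D f ->
  normc (cint D f) <= \int[mu]_(x in D) normc (f x).
Proof.
move=> mD fi; move zE : (cint D f) => z.
have [z0|z0] := eqVneq (normc z) 0.
  by rewrite z0 Rintegral_ge0// => x _; exact: normc_ge0.
pose c := ((normc z)^-1)%:C * z^*.
have nE : normc z = complex.Re (cint D (fun x => c * f x)).
  rewrite cintZ// zE /c cReM !cReM !cImM cReJ cImJ /= !mul0r subr0 addr0.
  have -> : (normc z)^-1 * complex.Re z * complex.Re z -
    (normc z)^-1 * - complex.Im z * complex.Im z =
    (normc z)^-1 * (complex.Re z ^+ 2 + complex.Im z ^+ 2) by ring.
  by rewrite -sqr_normcE expr2 mulrA mulVf// mul1r.
have nc : normc c = 1.
  by rewrite /c normcM normc_real ger0_norm ?invr_ge0 ?normc_ge0//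
   [normc _^*]normcE2 cReJ cImJ sqrrN -normcE2 mulVf.
rewrite nE /= le_Rintegral//.
- by case: (cintegrableZ c mD fi).
- exact: cintegrable_normc.
- by move=> x _; rewrite (le_trans (ler_norm _))// (le_trans (normc_geRe _))// normcM nc mul1r.
Qed.

End ComplexIntegral.

Section ComplexFubini.
Local Open Scope classical_set_scope.
Context {R : realType} d1 d2 (T1 : measurableType d1) (T2 : measurableType d2).
Local Notation C := R[i].
Variables (m1 : {sigma_finite_measure set T1 -> \bar R})
  (m2 : {sigma_finite_measure set T2 -> \bar R}).

(** The slices are integrable at every point, not just almost everywhere: a real integral is the
    finite part of an extended one, and the two can be exchanged only when the value is finite. *)
Lemma Rintegral_fubini (k : T1 * T2 -> R) :
  (m1 \x m2)%E.-integrable setT (EFin \o k) ->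
  (forall x, m2.-integrable setT (fun y => (k (x, y))%:E)) ->
  (forall y, m1.-integrable setT (fun x => (k (x, y))%:E)) ->
  m1.-integrable setT (fun x => (\int[m2]_y k (x, y))%:E) /\
  \int[m1]_x \int[m2]_y k (x, y) = \int[m2]_y \int[m1]_x k (x, y).
Proof.
move=> ik ik2 ik1.
have E2 x : (\int[m2]_y k (x, y))%:E = (\int[m2]_y (k (x, y))%:E)%E.
  by rewrite fineK//; exact: integrable_fin_num.
have E1 y : (\int[m1]_x k (x, y))%:E = (\int[m1]_x (k (x, y))%:E)%E.
  by rewrite fineK//; exact: integrable_fin_num.
split.
  by apply: eq_integrable (integrable_fubini_F ik) => // x _; rewrite E2.
congr fine; under eq_integral do rewrite E2.
by under [RHS]eq_integral do rewrite E1; exact: (Fubini ik).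
Qed.

Lemma cint_fubini (k : T1 * T2 -> C) :
  cintegrable (m1 \x m2)%E setT k ->
  (forall x, cintegrable m2 setT (fun y => k (x, y))) ->
  (forall y, cintegrable m1 setT (fun x => k (x, y))) ->
  cintegrable m1 setT (fun x => cint m2 setT (fun y => k (x, y))) /\
  cint m1 setT (fun x => cint m2 setT (fun y => k (x, y))) =
  cint m2 setT (fun y => cint m1 setT (fun x => k (x, y))).
Proof.
move=> [r i] hx hy.
have [r1 r2] := Rintegral_fubini r (fun x => (hx x).1) (fun y => (hy y).1).
have [i1 i2] := Rintegral_fubini i (fun x => (hx x).2) (fun y => (hy y).2).
by split; [split|apply: complexP].
Qed.

End ComplexFubini.

(** * Integrals of damped exponentials *)

Section ExponentialIntegrals.
Local Open Scope classical_set_scope.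
Context {R : realType}.
Local Notation C := R[i].
Local Notation mu := (@lebesgue_measure R).

(** The three equations say that [exp (- c t) (A + B cos (b t) + G sin (b t))] is an antiderivative
    of the integrand; it vanishes at infinity, which leaves minus its value at [a]. *)
Lemma damped_integral (c b al be ga A B G a : R) : 0 < c ->
  - c * A = al -> b * G - c * B = be -> - b * B - c * G = ga ->
  (forall t, 0 <= al + be * cos (b * t) + ga * sin (b * t)) ->
  (\int[mu]_(t in `[a, +oo[)
     (expR (- c * t) * (al + be * cos (b * t) + ga * sin (b * t)))%:E =
   (- (expR (- c * a) * (A + B * cos (b * a) + G * sin (b * a))))%:E)%E.
Proof.
move=> c0 hA hB hG f0.
pose F (t : R) : R := expR (- c * t) * (A + B * cos (b * t) + G * sin (b * t)).
pose f (t : R) : R := expR (- c * t) * (al + be * cos (b * t) + ga * sin (b * t)).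
have dF (t : R) : is_derive t 1 F (f t).
  apply: is_derive_eq.
  rewrite /f -hA -hB -hG /GRing.scale /=; ring.
have df (t : R) : derivable f t 1 by [].
have cf : continuous f by move=> t; apply/differentiable_continuous/derivable1_diffP.
have cF : continuous F by move=> t; apply/differentiable_continuous/derivable1_diffP.
rewrite -/f -/(F a) (@ge0_continuous_FTC2y _ f F a 0).
- by rewrite sub0e EFinN.
- by move=> x _; rewrite mulr_ge0 ?expR_ge0.
- exact: continuous_subspaceT.
- apply: (@cvgy_le_inv _ _ _ ((`|A| + `|B| + `|G|) * (1 + c^-1))) => w w0.
  rewrite subr0 /F normrM ger0_norm ?expR_ge0//.
  have h1 : `|A + B * cos (b * w) + G * sin (b * w)| <= `|A| + `|B| + `|G|.
    rewrite (le_trans (ler_normD _ _))// lerD//.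
      rewrite (le_trans (ler_normD _ _))// lerD2l normrM ler_piMr//.
      by rewrite ler_norml cos_geN1 cos_le1.
    by rewrite normrM ler_piMr// ler_norml sin_geN1 sin_le1.
  (* [1 + c w <= exp (c w)] turns exponential decay into the rate that [cvgy_le_inv] expects. *)
  have h2 : expR (- c * w) * (1 + w) <= 1 + c^-1.
    rewrite mulNr expRN mulrC ler_pdivrMr ?expR_gt0//.
    have h : 1 + c * w <= expR (c * w) by exact: expR_ge1Dx.
    apply: (@le_trans _ _ ((1 + c^-1) * (1 + c * w))).
      have -> : (1 + c^-1) * (1 + c * w) = 1 + w + (c * w + c^-1).
        by field; rewrite gt_eqF.
      by rewrite lerDl addr_ge0 ?invr_ge0 ?mulr_ge0// ltW.
    by rewrite ler_wpM2l// addr_ge0// invr_ge0 ltW.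
  by rewrite mulrAC mulrC ler_pM// ?mulr_ge0 ?expR_ge0 ?addr_ge0.
- by move=> x _.
- exact/cvg_at_right_filter/cF.
- by move=> x _; rewrite derive1E; exact: derive_val.
Qed.

Lemma damped_integrable (c b al be ga a : R) : 0 < c ->
  (forall t, 0 <= al + be * cos (b * t) + ga * sin (b * t)) ->
  mu.-integrable `[a, +oo[
    (fun t => (expR (- c * t) * (al + be * cos (b * t) + ga * sin (b * t)))%:E).
Proof.
move=> c0 f0.
have n0 : c ^+ 2 + b ^+ 2 != 0 by rewrite gt_eqF// ltr_pwDl ?exprn_gt0 ?sqr_ge0.
(* These values solve the three linear equations; the last two have determinant [c^2 + b^2]. *)
have E := @damped_integral c b al be ga (- al / c)
  (- (c * be + b * ga) / (c ^+ 2 + b ^+ 2))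
  ((b * be - c * ga) / (c ^+ 2 + b ^+ 2)) a c0.
apply/integrableP; split.
  apply/measurable_EFinP; apply: measurable_funTS; apply: continuous_measurable_fun => t.
  apply/differentiable_continuous/derivable1_diffP; by [].
under eq_integral do
  rewrite /= ger0_norm ?mulr_ge0 ?expR_ge0//.
rewrite E ?ltry//.
- by field; rewrite gt_eqF.
- by field.
- by field.
Qed.

Lemma expR_integrable (c a : R) : 0 < c ->
  mu.-integrable `[a, +oo[ (fun t => (expR (- c * t))%:E).
Proof.
move=> c0; have f0 (t : R) : 0 <= 1 + 0 * cos (0 * t) + 0 * sin (0 * t).
  by rewrite !mul0r !addr0.
apply: eq_integrable (damped_integrable a c0 f0) => // t _.
by rewrite !mul0r !addr0 mulr1.
Qed.

Lemma expR_integral (c a : R) : 0 < c ->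
  \int[mu]_(t in `[a, +oo[) expR (- c * t) = expR (- c * a) / c.
Proof.
move=> c0; have f0 (t : R) : 0 <= 1 + 0 * cos (0 * t) + 0 * sin (0 * t).
  by rewrite !mul0r !addr0.
have E := @damped_integral c 0 1 0 0 (- c^-1) 0 0 a c0 _ _ _ f0.
transitivity (\int[mu]_(t in `[a, +oo[)
    (expR (- c * t) * (1 + 0 * cos (0 * t) + 0 * sin (0 * t)))).
  by apply: eq_Rintegral => t _; rewrite !mul0r !addr0 mulr1.
rewrite /Rintegral E ?mul0r ?mulr0 ?oppr0 ?subr0 ?mulrNN ?mulfV ?gt_eqF ?addr0//=.
by rewrite mulrN opprK.
Qed.

(* The integrands are shifted by exp (- c t) so as to be nonnegative, as the
   improper fundamental theorem of calculus requires. *)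
Lemma cexp_integral (z : C) (a : R) : 0 < complex.Re z ->
  cintegrable mu `[a, +oo[ (fun t => cexp (- (z * t%:C))) /\
  cint mu `[a, +oo[ (fun t => cexp (- (z * t%:C))) = cexp (- (z * a%:C)) / z.
Proof.
case: z => c b /= c0.
have mD : measurable (`[a, +oo[ : set (measurableTypeR R)) by exact: measurable_itv.
have n0 : c ^+ 2 + b ^+ 2 != 0 by rewrite gt_eqF// ltr_pwDl ?exprn_gt0 ?sqr_ge0.
have zE t : - ((c +i* b) * t%:C) = (- c * t) +i* (- (b * t)).
  by apply: complexP; rewrite /=; ring.
have ReE t : complex.Re (cexp (- ((c +i* b) * t%:C))) =
    expR (- c * t) * (1 + 1 * cos (b * t) + 0 * sin (b * t)) - expR (- c * t).
  by rewrite zE /= cosN; ring.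
have ImE t : complex.Im (cexp (- ((c +i* b) * t%:C))) =
    expR (- c * t) - expR (- c * t) * (1 + 0 * cos (b * t) + 1 * sin (b * t)).
  by rewrite zE /= sinN; ring.
have p1 t : 0 <= 1 + 1 * cos (b * t) + 0 * sin (b * t).
  by have := cos_geN1 (b * t); lra.
have p2 t : 0 <= 1 + 0 * cos (b * t) + 1 * sin (b * t).
  by have := sin_geN1 (b * t); lra.
have i0 := expR_integrable a c0.
have i1 := damped_integrable a c0 p1.
have i2 := damped_integrable a c0 p2.
split.
  split; first by apply: eq_integrable (integrableB mD i1 i0) => // t _; rewrite ReE.
  by apply: eq_integrable (integrableB mD i0 i2) => // t _; rewrite ImE.
have e1 := @damped_integral c b 1 1 0 (- c^-1) (- c / (c ^+ 2 + b ^+ 2))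
  (b / (c ^+ 2 + b ^+ 2)) a c0.
have e2 := @damped_integral c b 1 0 1 (- c^-1) (- b / (c ^+ 2 + b ^+ 2))
  (- c / (c ^+ 2 + b ^+ 2)) a c0.
have rI : \int[mu]_(t in `[a, +oo[) complex.Re (cexp (- ((c +i* b) * t%:C))) =
    expR (- c * a) * (c * cos (b * a) - b * sin (b * a)) / (c ^+ 2 + b ^+ 2).
  under eq_Rintegral do rewrite ReE.
  rewrite RintegralB// expR_integral// /Rintegral e1//=.
  - by field; rewrite n0 gt_eqF.
  - by field; rewrite gt_eqF.
  - by field.
  - by field.
have iI : \int[mu]_(t in `[a, +oo[) complex.Im (cexp (- ((c +i* b) * t%:C))) =
    expR (- c * a) * (- b * cos (b * a) - c * sin (b * a)) / (c ^+ 2 + b ^+ 2).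
  under eq_Rintegral do rewrite ImE.
  rewrite RintegralB// expR_integral// /Rintegral e2//=.
  - by field; rewrite n0 gt_eqF.
  - by field; rewrite gt_eqF.
  - by field.
  - by field.
rewrite /cint rI iI zE.
by apply: complexP; rewrite /= cosN sinN; field.
Qed.

End ExponentialIntegrals.

(** * First-order filters on square-integrable signals *)

Section FirstOrderFilter.
Local Open Scope classical_set_scope.
Context {R : realType}.
Local Notation C := R[i].
Local Notation T := (measurableTypeR R).
Local Notation mu := (@lebesgue_measure R).
Local Notation time := (`[0%R, +oo[%classic : set T).
Implicit Types (s r : C) (f g : T -> C) (t x : T).

Let mtime : measurable time. Proof. exact: measurable_itv. Qed.

(* The response of 1 / (s - r) to f at time t is the integral over x of the
   value at (t, x) for s = 0; the factor exp (- s t) prepares its Laplace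
   transform. *)
Definition filter_kernel s r f (p : T * T) : C :=
  if (0 <= p.2) && (p.2 <= p.1)
  then cexp (- (s * (p.1 : R)%:C) + r * (p.1 - p.2 : R)%:C) * f p.2 else 0.

Lemma filter_kernel_measurable s r f : cmeasurable time f ->
  cmeasurable setT (filter_kernel s r f).
Proof.
move=> mf.
have m1 : measurable_fun setT (fst : T * T -> T) by exact: measurable_fst.
have m2 : measurable_fun setT (snd : T * T -> T) by exact: measurable_snd.
have mg := cmeasurable_comp (cmeasurable_restrict mtime mf) m2.
have mb : measurable_fun setT (fun p : T * T => ((0 : R) <= p.2) && (p.2 <= p.1)).
  by apply: measurable_and; apply: measurable_fun_ler => //; exact: measurable_cst.
apply: (eq_cmeasurable _ (cmeasurable_if mb (cmeasurableM (cmeasurable_cexp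
    (cmeasurableD (cmeasurableN (cmeasurableM (cmeasurable_cst _ s) (cmeasurable_real m1)))
    (cmeasurableM (cmeasurable_cst _ r) (cmeasurable_real (measurable_funB m1 m2))))) mg))).
move=> p _; rewrite /filter_kernel; case: ifP => //= /andP[p0 _].
by rewrite /crestrict mem_set//= in_itv/= p0.
Qed.

Lemma normc_filter_kernel s r f t x : 0 <= x -> x <= t ->
  normc (filter_kernel s r f (t, x)) =
  expR (- complex.Re (s - r) * t) * (expR (- complex.Re r * x) * normc (f x)).
Proof.
move=> x0 xt; rewrite /filter_kernel /= x0 xt /= normcM normc_cexp mulrA -expRD.
rewrite cReD cReN !cReM /= !mulr0 !subr0 cReD cReN; congr (expR _ * _); ring.
Qed.

Section Kernel.
Variables (s r : C) (f : T -> C).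
Hypothesis sr : 0 < complex.Re (s - r).
Hypothesis mf : cmeasurable time f.
Hypothesis fi : mu.-integrable time
  (fun x => (expR (- complex.Re s * x) * normc (f x))%:E).

Let k := filter_kernel s r f.

Let kernel_le t x : 0 <= x -> x <= t ->
  normc (k (t, x)) <= expR (- complex.Re s * x) * normc (f x).
Proof.
move=> x0 xt; rewrite normc_filter_kernel// mulrA ler_wpM2r ?normc_ge0//.
rewrite -expRD ler_expR !mulNr -opprD lerN2.
have -> : complex.Re s * x = complex.Re (s - r) * x + complex.Re r * x.
  by rewrite cReD cReN; ring.
by rewrite lerD2r ler_wpM2l// ltW.
Qed.

Lemma filter_kernel_slice t : cintegrable mu setT (fun x => k (t, x)).
Proof.
have mk1 : cmeasurable setT (fun x => k (t, x)).
  apply: (cmeasurable_comp (filter_kernel_measurable s r mf)).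
  exact: measurable_pair1.
have h := (integrable_mkcond _ mtime).1 fi; rewrite restrict_EFin in h.
apply: (@cintegrable_le R _ T mu setT _
  ((fun x => expR (- complex.Re s * x) * normc (f x)) \_ time)) => //.
move=> x _; rewrite patchE; case: ifPn => xt.
  move: xt; rewrite inE/= in_itv/= andbT => x0.
  have [xt|tx] := leP x t; first exact: kernel_le.
  rewrite /k /filter_kernel /= (lt_geF tx) andbF normc0.
  by rewrite mulr_ge0 ?expR_ge0 ?normc_ge0.
rewrite /k /filter_kernel /=; case: ifP; last by rewrite normc0.
by move=> /andP[x0]; move: xt; rewrite notin_setE/= in_itv/= x0.
Qed.

(** The convolution theorem, one slice at a time: for fixed [x] the kernel is a constant times
    [exp (- (s - r) t)] on [[x, +oo[], and the lower end [x] turns the constant into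
    [exp (- s x) f x]. *)
Let slice_integral x : time x ->
  cintegrable mu setT (fun t => k (t, x)) /\
  cint mu setT (fun t => k (t, x)) = cexp (- (s * x%:C)) * f x / (s - r).
Proof.
rewrite /= in_itv/= andbT => x0.
have mD : measurable (`[x, +oo[ : set T) by exact: measurable_itv.
have [ci cE] := cexp_integral x sr.
have kE : (fun t => k (t, x)) = crestrict `[x, +oo[
    (fun t => cexp (- (r * x%:C)) * f x * cexp (- ((s - r) * t%:C))).
  apply/funext => t; rewrite /k /filter_kernel /crestrict /= x0 /=.
  have -> : (t \in `[x, +oo[%classic) = (x <= t).
    by apply/idP/idP; rewrite inE/= in_itv/= andbT.
  case: ifP => // _; rewrite mulrAC -cexpD; congr (cexp _ * _).
  by rewrite !rmorphB/=; ring.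
rewrite kE -cint_restrict; split.
  by apply/(cintegrable_restrict _ _ mD); exact: cintegrableZ.
rewrite cintZ// cE mulrA; congr (_ / _); rewrite mulrAC -cexpD; congr (cexp _ * _).
ring.
Qed.

Let slice_integral0 x : ~ time x -> forall t, k (t, x) = 0.
Proof.
move=> x0 t; rewrite /k /filter_kernel /=; case: ifP => // /andP[x0' _].
by exfalso; apply: x0; rewrite /= in_itv/= x0'.
Qed.

Let slice_integrable2 x : cintegrable mu setT (fun t => k (t, x)).
Proof.
have [tx|tx] := pselect (time x); first by case: (slice_integral tx).
have -> : (fun t => k (t, x)) = (fun=> 0).
  by apply/funext => t; exact: slice_integral0.
by split; exact: integrable0.
Qed.

Let slice_norm x : (\int[mu]_t (normc (k (t, x)))%:E =
  (((fun x => (complex.Re (s - r))^-1 * (expR (- complex.Re s * x) * normc (f x)))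
    \_ time) x)%:E)%E.
Proof.
have [tx|tx] := pselect (time x); last first.
  rewrite patchE memNset//; under eq_integral do rewrite slice_integral0// normc0.
  by rewrite integral0.
rewrite patchE mem_set//; have x0 : 0 <= x by move: tx; rewrite /= in_itv/= andbT.
transitivity (\int[mu]_(t in `[x, +oo[)
    (expR (- complex.Re (s - r) * t) * (expR (- complex.Re r * x) * normc (f x)))%:E)%E.
  rewrite [RHS]integral_mkcond; apply: eq_integral => t _; rewrite patchE.
  have [xt|tx'] := leP x t.
    by rewrite mem_set/= ?in_itv/= ?andbT// normc_filter_kernel.
  rewrite memNset/= ?in_itv/= ?andbT; last by apply/negP; rewrite -ltNge.
  by rewrite /k /filter_kernel /= (lt_geF tx') andbF normc0.
under eq_integral do rewrite EFinM.
have ei := expR_integrable x sr.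
have mD : measurable (`[x, +oo[ : set T) by exact: measurable_itv.
rewrite integralZr// -[X in (X * _)%E]fineK; last exact: integrable_fin_num.
rewrite -/(Rintegral _ _ _) expR_integral// -EFinM; congr EFin.
have -> : expR (- complex.Re s * x) =
    expR (- complex.Re (s - r) * x) * expR (- complex.Re r * x).
  by rewrite -expRD; congr expR; rewrite cReD cReN; ring.
by rewrite mulrAC !mulrA mulrC !mulrA.
Qed.

(** Tonelli, with the modulus integrated over [t] first: the inner integral is exactly the
    integrable weight divided by [Re (s - r)]. *)
Lemma filter_kernel_integrable : cintegrable (mu \x mu)%E setT k.
Proof.
have mk := filter_kernel_measurable s r mf.
apply: (@cintegrable_le R _ (T * T)%type (mu \x mu)%E setT _ (fun p => normc (k p))) => //.
apply/integrable21ltyP; first exact/measurable_EFinP/measurable_normc.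
under eq_integral do under eq_integral do rewrite /= ger0_norm ?normc_ge0//.
under eq_integral do rewrite slice_norm.
have hi := integrableZl mtime (complex.Re (s - r))^-1 fi.
have := integrable_lty measurableT ((integrable_mkcond _ mtime).1 hi).
by rewrite restrict_EFin.
Qed.

(** Serves twice: for the signal itself, to find the transform of the filter output; and at [s = 0]
    for [|f|^2] filtered with pole [Re r], to see that the bound on the squared output is
    integrable. *)
Lemma filter_kernel_fubini :
  cintegrable mu setT (fun t => cint mu setT (fun x => k (t, x))) /\
  cint mu setT (fun t => cint mu setT (fun x => k (t, x))) =
  cint mu time (fun x => cexp (- (s * x%:C)) * f x) / (s - r).
Proof.
have ci : cintegrable mu time (fun x => cexp (- (s * x%:C)) * f x).
  apply: (@cintegrable_le R _ T mu time _
    (fun x => expR (- complex.Re s * x) * normc (f x))) => //.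
    apply: cmeasurableM => //; apply: cmeasurable_cexp; apply: cmeasurableN.
    apply: cmeasurableM; first exact: cmeasurable_cst.
    by apply: cmeasurable_real; exact: measurable_id.
  move=> x _; rewrite normcM normc_cexp cReN cReM /= mulr0 subr0 mulNr.
  by [].
have [h1 h2] := cint_fubini filter_kernel_integrable filter_kernel_slice slice_integrable2.
split; first exact: h1.
apply: (etrans h2).
rewrite [RHS]mulrC -(cintZ _ mtime ci) [RHS]cint_restrict; apply: eq_cint => x _.
move: {h1 h2} x => x.
rewrite /crestrict; have [xt|xt] := boolP (x \in time).
  by move: xt; rewrite inE => xt; have [_ ->] := slice_integral xt; rewrite mulrC.
rewrite -[RHS](cint0 mu setT); apply: eq_cint => t _.
by apply: slice_integral0; move: xt; rewrite notin_setE.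
Qed.

End Kernel.

Definition L2signal f := cmeasurable time f /\
  mu.-integrable time (fun t => (normc (f t) ^+ 2)%:E).

(** For [0 <= e <= 1] and [m >= 0], [e m <= e + m^2]: compare with [e] if [m <= 1] and with [m^2]
    otherwise. *)
Lemma L2signal_damped f (c : R) : 0 < c -> L2signal f ->
  mu.-integrable time (fun t => (expR (- c * t) * normc (f t))%:E).
Proof.
move=> c0 [mf fi].
apply: le_integrable (integrableD mtime (expR_integrable 0 c0) fi) => //.
  apply/measurable_EFinP/measurable_funM; last exact: measurable_normc.
  apply: measurableT_comp => //; apply: measurable_funM => //.
move=> t; rewrite /= in_itv/= andbT => t0; rewrite lee_fin.
have e0 : 0 <= expR (- c * t) := expR_ge0 _.
have e1 : expR (- c * t) <= 1.
  by rewrite -expR0 ler_expR mulNr oppr_le0 mulr_ge0// ltW.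
have m0 := normc_ge0 (f t).
rewrite !ger0_norm ?mulr_ge0 ?addr_ge0 ?sqr_ge0//.
move: (expR _) (normc _) e0 e1 m0 => e m e0 e1 m0; nra.
Qed.

Lemma L2signal_laplace f s : 0 < complex.Re s -> L2signal f ->
  cintegrable mu time (fun t => cexp (- (s * t%:C)) * f t).
Proof.
move=> s0 fL; have [mf _] := fL.
apply: (@cintegrable_le R _ T mu time _
    (fun x => expR (- complex.Re s * x) * normc (f x))) => //.
  apply: cmeasurableM => //; apply: cmeasurable_cexp; apply: cmeasurableN.
  apply: cmeasurableM; first exact: cmeasurable_cst.
  by apply: cmeasurable_real; exact: measurable_id.
  exact: L2signal_damped.
by move=> x _; rewrite normcM normc_cexp cReN cReM /= mulr0 subr0 mulNr.
Qed.

(** The integral is [(1 - exp (a t)) / (- a)]: the impulse response has mass at most [1 / (- a)],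
    uniformly in [t]. *)
Lemma decay_integral (a t : R) : a < 0 -> 0 <= t ->
  mu.-integrable setT (fun x => (complex.Re
     (filter_kernel 0 a%:C (fun=> 1) (t, x)))%:E) /\
  \int[mu]_x complex.Re (filter_kernel 0 a%:C (fun=> 1) (t, x)) <= (- a)^-1.
Proof.
move=> a0 t0.
have mD : measurable (`[0, t] : set T) by exact: measurable_itv.
pose h (x : R) : R := expR (a * (t - x)).
have kE : (fun x : T => complex.Re (filter_kernel 0 a%:C (fun=> 1) (t, x))) =
    h \_ `[0, t].
  apply/funext => x; rewrite patchE /filter_kernel /=.
  have -> : (x \in `[0, t]%classic) = (0 <= x) && (x <= t).
    by apply/idP/idP; rewrite inE/= in_itv/=.
  case: ifP => // _.
  by rewrite mulr1 mul0r oppr0 add0r -rmorphM cexp_real.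
have ch : continuous h.
  by move=> x; apply/differentiable_continuous/derivable1_diffP.
have ih : mu.-integrable `[0, t] (EFin \o h).
  apply: continuous_compact_integrable; first exact: segment_compact.
  exact: continuous_subspaceT.
have kEx x : complex.Re (filter_kernel 0 a%:C (fun=> 1) (t, x)) = (h \_ `[0, t]) x.
  exact: (congr1 (@^~ x) kE).
split.
  apply: eq_integrable ((integrable_mkcond _ mD).1 ih) => // x _.
  by rewrite restrict_EFin /= -kEx.
under eq_Rintegral do rewrite kEx.
(* The fundamental theorem of calculus requires a nondegenerate interval, so [t = 0] is separate. *)
rewrite -Rintegral_mkcond; move: t0; rewrite le_eqVlt => /predU1P[<-|t0'].
  by rewrite set_itv1 Rintegral_set1 invr_ge0 oppr_ge0 ltW.
pose G (x : R) : R := - (a^-1 * expR (a * (t - x))).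
have dG (x : R) : is_derive x 1 G (h x).
  apply: is_derive_eq; rewrite /h /GRing.scale /=; field.
  by rewrite lt_eqF.
have cG : continuous G.
  by move=> x; apply/differentiable_continuous/derivable1_diffP.
rewrite /Rintegral (@continuous_FTC2 _ h G 0 t)//.
- rewrite /G /= subrr mulr0 subr0 expR0 mulr1 opprK invrN.
  by rewrite gerDl nmulr_rle0 ?invr_lt0// expR_ge0.
- exact: continuous_subspaceT.
- split; first by move=> x _.
    exact/cvg_at_right_filter/cG.
  exact/cvg_at_left_filter/cG.
- by move=> x _; rewrite derive1E; exact: derive_val.
Qed.

Lemma cint_Re D f : complex.Re (cint mu D f) = \int[mu]_(x in D) complex.Re (f x).
Proof. by []. Qed.

(** Cauchy-Schwarz with weight [exp (Re r (t - x))], whose mass [decay_integral] bounds. The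
    right-hand side is again a first-order filter, now applied to [|f|^2]; integrating it over [t]
    amounts to Young's convolution inequality. *)
Lemma first_order_filter_bound f (r : C) (t : T) : complex.Re r < 0 -> 0 <= t ->
  L2signal f ->
  normc (cint mu setT (fun x => filter_kernel 0 r f (t, x))) ^+ 2 <=
  (- complex.Re r)^-1 * complex.Re (cint mu setT (fun x =>
     filter_kernel 0 (complex.Re r)%:C (fun x => (normc (f x) ^+ 2)%:C) (t, x))).
Proof.
move=> r0 t0 fL; have [mf fi] := fL; set a := complex.Re r.
set m := normc _; set G := complex.Re _.
have ms : cmeasurable time (fun x => (normc (f x) ^+ 2)%:C).
  by apply: cmeasurable_real; apply: measurable_funX; exact: measurable_normc.
have a0 : 0 < complex.Re (0 - a%:C) by rewrite sub0r /= oppr_gt0.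
have fi' : mu.-integrable time
    (fun x => (expR (- complex.Re 0 * x) * normc (normc (f x) ^+ 2)%:C)%:E).
  apply: eq_integrable fi => // x _.
  by rewrite /= oppr0 mul0r expR0 mul1r expr0n addr0 sqrtr_sqr ger0_norm ?sqr_ge0.
have [is2 _] := filter_kernel_slice a0 ms fi' t.
have [i1 E1] := decay_integral r0 t0.
rewrite -/a in i1 E1.
have eE x : cexp (- (0 * t%:C) + a%:C * (t - x)%:C) = (expR (a * (t - x)))%:C.
  by rewrite mul0r oppr0 add0r -rmorphM cexp_real.
have kE (g : T -> R) x : complex.Re (filter_kernel 0 a%:C (fun x => (g x)%:C) (t, x)) =
    complex.Re (filter_kernel 0 a%:C (fun=> 1) (t, x)) * g x.
  rewrite /filter_kernel [fst _]/= [snd _]/=; case: ifP => _; last by rewrite mul0r.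
  by rewrite eE mulr1 cReM /= mul0r subr0.
have nE x : normc (filter_kernel 0 r f (t, x)) =
    complex.Re (filter_kernel 0 a%:C (fun=> 1) (t, x)) * normc (f x).
  rewrite /filter_kernel [fst _]/= [snd _]/=; case: ifP => _; last by rewrite normc0 mul0r.
  rewrite eE mulr1 normcM normc_cexp mul0r oppr0 add0r cReM.
  by rewrite [complex.Im (t - x)%:C]/= mulr0 subr0.
have k0 x : 0 <= complex.Re (filter_kernel 0 a%:C (fun=> 1) (t, x)).
  rewrite /filter_kernel [fst _]/= [snd _]/=; case: ifP => _ //.
  by rewrite eE mulr1 /= expR_ge0.
have mk : cmeasurable setT (fun x => filter_kernel 0 r f (t, x)).
  apply: (cmeasurable_comp (filter_kernel_measurable 0 r mf)).
  exact: measurable_pair1.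
(* Optimizing lam in this AM-GM bound replaces the Cauchy-Schwarz inequality. *)
have amgm lam x : 0 < lam -> normc (filter_kernel 0 r f (t, x)) <=
    lam / 2 * complex.Re (filter_kernel 0 a%:C (fun=> 1) (t, x)) +
    (2 * lam)^-1 * complex.Re (filter_kernel 0 a%:C (fun x => (normc (f x) ^+ 2)%:C) (t, x)).
  move=> l0; rewrite nE (kE (fun x => normc (f x) ^+ 2)).
  rewrite [X in _ + X]mulrCA [lam / 2 * _]mulrC -mulrDr ler_wpM2l//.
  rewrite -subr_ge0.
  have -> : lam / 2 + (2 * lam)^-1 * normc (f x) ^+ 2 - normc (f x) =
    (2 * lam)^-1 * (lam - normc (f x)) ^+ 2 by field; rewrite gt_eqF.
  by rewrite mulr_ge0 ?sqr_ge0// invr_ge0 mulr_ge0 ?ltW.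
have isum lam : mu.-integrable setT (fun x => (lam / 2 *
    complex.Re (filter_kernel 0 a%:C (fun=> 1) (t, x)) + (2 * lam)^-1 *
    complex.Re (filter_kernel 0 a%:C (fun x => (normc (f x) ^+ 2)%:C) (t, x)))%:E).
  exact: (integrableD measurableT (integrableZl measurableT (lam / 2) i1)
    (integrableZl measurableT (2 * lam)^-1 is2)).
have ik : cintegrable mu setT (fun x => filter_kernel 0 r f (t, x)).
  apply: (cintegrable_le measurableT mk (isum 1)) => x _; exact: amgm.
have mle lam : 0 < lam -> m <= lam / 2 * (- a)^-1 + (2 * lam)^-1 * G.
  move=> l0; apply: (le_trans (normc_cint measurableT ik)).
  apply: (@le_trans _ _ (\int[mu]_x (lam / 2 *
    complex.Re (filter_kernel 0 a%:C (fun=> 1) (t, x)) + (2 * lam)^-1 *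
    complex.Re (filter_kernel 0 a%:C (fun x => (normc (f x) ^+ 2)%:C) (t, x))))).
    apply: le_Rintegral (isum lam) _ => //; first exact: cintegrable_normc.
    by move=> x _; exact: amgm.
  rewrite RintegralD//; last 2 first.
  - exact: (integrableZl measurableT (lam / 2) i1).
  - exact: (integrableZl measurableT (2 * lam)^-1 is2).
  rewrite !RintegralZl// lerD2r ler_wpM2l// divr_ge0//; exact: ltW.
have G0 : 0 <= G.
  by rewrite /G cint_Re Rintegral_ge0// => x _; rewrite (kE (fun x => normc (f x) ^+ 2)) mulr_ge0 ?sqr_ge0.
have [->|m0] := eqVneq m 0.
  by rewrite expr0n mulr_ge0// invr_ge0 oppr_ge0 ltW.
have mn0 := m0.
have {}m0 : 0 < m by rewrite lt_neqAle eq_sym m0 normc_ge0.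
have an0 : a != 0 by rewrite lt_eqF.
(* With [lam = m * - a] the first term of [mle] is [m / 2], which the left-hand side absorbs. *)
have := mle (m * - a); rewrite mulr_gt0 ?oppr_gt0// => /(_ erefl) h.
have {}h : m <= (m * - a)^-1 * G.
  have e1 : m * - a / 2 / - a = m / 2 by field; rewrite ?an0.
  have e2 : (2 * (m * - a))^-1 * G = (m * - a)^-1 * G / 2.
    by field; rewrite ?mn0 ?an0.
  by move: h; rewrite e1 e2; lra.
rewrite expr2; apply: le_trans (ler_wpM2l (ltW m0) h) _.
rewrite mulrA le_eqVlt; apply/orP; left; apply/eqP.
by field; rewrite ?mn0 ?an0.
Qed.

Lemma first_order_filter f (r : C) : complex.Re r < 0 -> L2signal f ->
  exists2 y : T -> C, L2signal y & forall s, 0 < complex.Re s ->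
    cint mu time (fun t => cexp (- (s * t%:C)) * y t) =
    cint mu time (fun t => cexp (- (s * t%:C)) * f t) / (s - r).
Proof.
move=> r0 fL; have [mf fi] := fL.
pose y (t : T) := cint mu setT (fun x => filter_kernel 0 r f (t, x)).
have sr0 s : 0 < complex.Re s -> 0 < complex.Re (s - r).
  by move=> s0; rewrite cReD cReN subr_gt0 (lt_trans r0).
have wi s : 0 < complex.Re s -> mu.-integrable time
    (fun x => (expR (- complex.Re s * x) * normc (f x))%:E).
  by move=> s0; exact: L2signal_damped.
have kE s t : 0 < complex.Re s -> cexp (- (s * t%:C)) * y t =
    cint mu setT (fun x => filter_kernel s r f (t, x)).
  move=> s0; rewrite /y.
  have E x : filter_kernel 0 r f (t, x) =
      cexp (s * t%:C) * filter_kernel s r f (t, x).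
    rewrite /filter_kernel /=; case: ifP => _; last by rewrite mulr0.
    by rewrite mulrA -cexpD; congr (cexp _ * _); ring.
  under eq_cint do rewrite E.
  rewrite cintZ//; last exact: (filter_kernel_slice (sr0 s s0) mf (wi s s0)).
  by rewrite mulrA cexpN_mul mul1r.
have yE s : 0 < complex.Re s -> cintegrable mu time (fun t => cexp (- (s * t%:C)) * y t) /\
    cint mu time (fun t => cexp (- (s * t%:C)) * y t) =
    cint mu time (fun t => cexp (- (s * t%:C)) * f t) / (s - r).
  move=> s0; have [h1 h2] := filter_kernel_fubini (sr0 s s0) mf (wi s s0).
  have rE : crestrict time (fun t => cexp (- (s * t%:C)) * y t) =
      (fun t => cint mu setT (fun x => filter_kernel s r f (t, x))).
    apply/funext => t; rewrite /crestrict; case: ifPn => [_|]; first exact: kE.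
    rewrite notin_setE/= in_itv/= andbT => /negP; rewrite -ltNge => t0.
    rewrite -[LHS](cint0 mu setT); apply: eq_cint => x _; rewrite /filter_kernel /=.
    case: ifP => // /andP[x0 xt].
    by have := lt_le_trans t0 x0; rewrite ltNge xt.
  split; first by apply/(cintegrable_restrict _ _ mtime); rewrite rE.
  by rewrite cint_restrict rE.
exists y; last by move=> s /yE[].
have my : cmeasurable time y.
  (* Measurability of [y] is read off Fubini at [s = 1] by undoing the factor [exp (- t)]. *)
  have [h _] := yE 1 ltr01.
  apply: (eq_cmeasurable _ (cmeasurableM (cmeasurable_cexp (cmeasurable_real
    (@measurable_id _ T time))) (cintegrable_measurable h))) => t _.
  by rewrite mulrA -cexpD mul1r subrr cexp0 mul1r.
split=> //.
set a := complex.Re r in r0.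
have ms : cmeasurable time (fun x => (normc (f x) ^+ 2)%:C).
  by apply: cmeasurable_real; apply: measurable_funX; exact: measurable_normc.
have a0 : 0 < complex.Re (0 - a%:C) by rewrite sub0r /= oppr_gt0.
have fi' : mu.-integrable time
    (fun x => (expR (- complex.Re 0 * x) * normc (normc (f x) ^+ 2)%:C)%:E).
  apply: eq_integrable fi => // x _.
  by rewrite /= oppr0 mul0r expR0 mul1r expr0n addr0 sqrtr_sqr ger0_norm ?sqr_ge0.
have [[h1 _] _] := filter_kernel_fubini a0 ms fi'.
have h2 := integrableS measurableT mtime (@subsetT _ _) h1.
apply: le_integrable (integrableZl mtime (- a)^-1 h2) => //.
  by apply/measurable_EFinP/measurable_funX/measurable_normc.
move=> t; rewrite /= in_itv/= andbT => t0; rewrite lee_fin ger0_norm ?sqr_ge0//.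
by apply: le_trans (ler_norm _); exact: first_order_filter_bound.
Qed.

End FirstOrderFilter.

(** * Uniqueness of the Laplace transform *)

Section LaplaceUniqueness.
Local Open Scope classical_set_scope.
Context {R : realType}.
Local Notation C := R[i].
Local Notation T := (measurableTypeR R).
Local Notation mu := (@lebesgue_measure R).
Local Notation time := (`[0%R, +oo[%classic : set T).

Let mtime : measurable time. Proof. exact: measurable_itv. Qed.

Lemma bernoulli_lower (y : R) m : 0 <= y <= 1 -> 1 - m%:R * y <= (1 - y) ^+ m.
Proof.
move=> /andP[y0 y1]; elim: m => [|m IH]; first by rewrite mul0r subr0 expr0.
rewrite exprS -natr1; apply: (@le_trans _ _ ((1 - y) * (1 - m%:R * y))).
  have -> : (1 - y) * (1 - m%:R * y) = 1 - (m%:R + 1) * y + m%:R * y ^+ 2 by ring.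
  by rewrite lerDl mulr_ge0 ?sqr_ge0.
by rewrite ler_wpM2l// subr_ge0.
Qed.

Lemma bernoulli_upper (y : R) m : 0 <= y <= 1 -> (1 - y) ^+ m * (m%:R * y) <= 1.
Proof.
move=> /andP[y0 y1].
have h0 k : 0 <= (1 - y) ^+ k by rewrite exprn_ge0// subr_ge0.
(* The induction goes through for the stronger bound with [1 + m y]. *)
suff h : (1 - y) ^+ m * (1 + m%:R * y) <= 1.
  by apply: le_trans h; rewrite ler_wpM2l// lerDr.
elim: m => [|m IH]; first by rewrite mul0r addr0 expr0 mulr1.
apply: le_trans IH; rewrite exprSr -mulrA ler_wpM2l// -natr1.
have -> : (1 - y) * (1 + (m%:R + 1) * y) =
  1 + m%:R * y - (m%:R + 1) * y ^+ 2 by ring.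
by rewrite gerBl mulr_ge0 ?sqr_ge0 ?addr_ge0.
Qed.

(* The polynomials (1 - x^n)^(2^n) of Brosowski and Deutsch approximate the
   indicator function of [0, 1/2[; with x = exp (- t ln 2 / a) they show that a
   signal with zero Laplace transform has zero integral over ]a, +oo[. *)
Lemma cvg_step_lt (x : R) : 0 <= x -> x < 2^-1 ->
  (1 - x ^+ n) ^+ (2 ^ n) @[n --> \oo] --> (1 : R).
Proof.
move=> x0 xh.
have x1 : x <= 1 by apply: le_trans (ltW xh) _; rewrite invf_le1 ?ler1n.
apply: (@squeeze_cvgr _ _ _ _ (fun n => 1 - (2 * x) ^+ n) (fun=> 1)).
- near=> n; apply/andP; split.
    have y01 : 0 <= x ^+ n <= 1 by rewrite exprn_ge0// exprn_ile1.
    by have := bernoulli_lower (2 ^ n) y01; rewrite natrX -exprMn.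
  by rewrite exprn_ile1// ?subr_ge0 ?exprn_ile1// gerBl exprn_ge0.
- rewrite -[X in _ --> X](subr0 (1 : R)); apply: cvgB; first exact: cvg_cst.
  apply: cvg_expr; rewrite ger0_norm ?mulr_ge0// mulrC -ltr_pdivlMr// div1r//.
- exact: cvg_cst.
Unshelve. all: by end_near. Qed.

Lemma cvg_step_gt (x : R) : 2^-1 < x -> x <= 1 ->
  (1 - x ^+ n) ^+ (2 ^ n) @[n --> \oo] --> (0 : R).
Proof.
move=> xh x1.
have x0 : 0 < x by apply: lt_trans xh; rewrite invr_gt0.
have xx0 : 0 < 2 * x by rewrite mulr_gt0.
apply: (@squeeze_cvgr _ _ _ _ (fun=> 0) (fun n => ((2 * x)^-1) ^+ n)).
- near=> n.
  have xg := ltW x0.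
  have y01 : 0 <= x ^+ n <= 1 by rewrite exprn_ge0// exprn_ile1.
  apply/andP; split; first by rewrite exprn_ge0// subr_ge0; case/andP: y01.
  have := bernoulli_upper (2 ^ n) y01; rewrite natrX -exprMn.
  by rewrite -ler_pdivlMr ?exprn_gt0// div1r exprVn.
- exact: cvg_cst.
- apply: cvg_expr; rewrite ger0_norm ?invr_ge0 ?ltW// invf_lt1//.
  by rewrite -ltr_pdivrMl ?mulr1.
Unshelve. all: by end_near. Qed.

Section RealSignal.
Variables (g : T -> R) (sigma : R).
Hypothesis gi : forall s, sigma < s ->
  mu.-integrable time (fun t => (expR (- s * t) * g t)%:E).
Hypothesis g0 : forall s, sigma < s -> \int[mu]_(t in time) (expR (- s * t) * g t) = 0.

Let G (t : T) : R := expR (- (sigma + 1) * t) * g t.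

Let Gi : mu.-integrable time (fun t => (G t)%:E).
Proof. by apply: gi; rewrite ltrDl. Qed.

(** Each factor [1 - exp (- b t)] splits a moment into those at [c] and at [c + b], so [c] stays
    general in the induction. Without factors the integral is the transform at [sigma + 1 + c],
    which is zero. *)
Lemma damped_moment (b : R) m (c : R) : 0 <= b -> 0 <= c ->
  mu.-integrable time
    (fun t => ((1 - expR (- b * t)) ^+ m * expR (- c * t) * G t)%:E) /\
  \int[mu]_(t in time) ((1 - expR (- b * t)) ^+ m * expR (- c * t) * G t) = 0.
Proof.
move=> b0; elim: m c => [|m IH] c c0.
  have h : sigma < sigma + 1 + c by rewrite -addrA ltrDl ltr_pwDl.
  have E t : (1 - expR (- b * t)) ^+ 0 * expR (- c * t) * G t =
      expR (- (sigma + 1 + c) * t) * g t.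
    by rewrite expr0 mul1r /G mulrA -expRD; congr (expR _ * _); ring.
  split; first by apply: eq_integrable (gi h) => // t _; rewrite E.
  by under eq_Rintegral do rewrite E; exact: g0.
have [i1 e1] := IH c c0.
have [i2 e2] := IH (c + b) (addr_ge0 c0 b0).
have E t : (1 - expR (- b * t)) ^+ m.+1 * expR (- c * t) * G t =
    (1 - expR (- b * t)) ^+ m * expR (- c * t) * G t -
    (1 - expR (- b * t)) ^+ m * expR (- (c + b) * t) * G t.
  have -> : expR (- (c + b) * t) = expR (- c * t) * expR (- b * t).
    by rewrite -expRD; congr expR; ring.
  by rewrite exprSr; ring.
split; first by apply: eq_integrable (integrableB mtime i1 i2) => // t _; rewrite E.
under eq_Rintegral do rewrite E.
by rewrite RintegralB// e1 e2 subr0.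
Qed.

Lemma tail_integral (a : R) : 0 < a -> \int[mu]_(t in `]a, +oo[) G t = 0.
Proof.
move=> a0.
pose h := ln 2 / a.
have h0 : 0 < h by rewrite divr_gt0// ln_gt0// ltr1n.
pose f n (t : T) : R := (1 - expR (- (n%:R * h) * t)) ^+ (2 ^ n) * G t.
have fi n : mu.-integrable time (fun t => (f n t)%:E) /\
    \int[mu]_(t in time) f n t = 0.
  have nh : 0 <= n%:R * h by rewrite mulr_ge0// ltW.
  have [i e] := damped_moment (2 ^ n) nh (lexx 0).
  have E t : (1 - expR (- (n%:R * h) * t)) ^+ (2 ^ n) * expR (- 0 * t) * G t = f n t.
    by rewrite oppr0 mul0r expR0 mulr1.
  split; first by apply: eq_integrable i => // t _; rewrite E.
  by rewrite -[RHS]e; apply: eq_Rintegral => t _; rewrite E.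
have mT : measurable (`]a, +oo[ : set T) by exact: measurable_itv.
pose F : T -> \bar R := (fun t => (G t)%:E) \_ `]a, +oo[.
have mF : measurable_fun time F.
  apply: measurable_funTS; apply/(measurable_restrictT _ mT).
  apply: measurable_funS (measurable_int _ Gi) => // t.
  by rewrite /= !in_itv/= !andbT => at'; rewrite ltW// (lt_trans a0).
have cF : {ae mu, forall t, time t -> (f n t)%:E @[n --> \oo] --> F t}.
  (* At [t = a], where [x = 1/2], the powers tend to [1/e], neither 0 nor 1; the point is null. *)
  exists [set a]; split; [exact: measurable_set1|exact: lebesgue_measure_set1|].
  move=> t /= /not_implyP[]; rewrite in_itv/= andbT => t0; apply: contra_notP => ta.
  pose x := expR (- h * t).
  have fE n : f n t = (1 - x ^+ n) ^+ (2 ^ n) * G t.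
    by rewrite /f /x -expRM_natl; congr ((1 - expR _) ^+ _ * _); ring.
  have x0 : 0 <= x := expR_ge0 _.
  have half : 2^-1 = expR (- h * a).
    by rewrite /h mulNr divfK ?gt_eqF// expRN lnK// posrE.
  have [ta'|at'|//] := ltgtP t a.
  - have -> : F t = 0%:E.
      rewrite /F patchE memNset//= in_itv/= andbT; apply/negP.
      by rewrite -leNgt ltW.
    apply: (@cvg_EFin _ _ _ _ (fun n => (f n t)%:E)); first exact: nearW.
    rewrite (_ : fine \o _ = fun n => (1 - x ^+ n) ^+ (2 ^ n) * G t); last first.
      by apply/funext => n; exact: fE.
    rewrite -(mul0r (G t)); apply: cvgMl; apply: cvg_step_gt.
      by rewrite half ltr_expR !mulNr ltrN2 ltr_pM2l.
    by rewrite /x -expR0 ler_expR mulNr oppr_le0 mulr_ge0// ltW.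
  - have -> : F t = (G t)%:E.
      by rewrite /F patchE mem_set//= in_itv/= at'.
    apply: (@cvg_EFin _ _ _ _ (fun n => (f n t)%:E)); first exact: nearW.
    rewrite (_ : fine \o _ = fun n => (1 - x ^+ n) ^+ (2 ^ n) * G t); last first.
      by apply/funext => n; exact: fE.
    rewrite -[X in _ --> X](mul1r (G t)); apply: cvgMl; apply: cvg_step_lt => //.
    by rewrite half ltr_expR !mulNr ltrN2 ltr_pM2l.
have fle : {ae mu, forall t n, time t -> (`|(f n t)%:E| <= `|(G t)%:E|)%E}.
  apply: aeW => t n; rewrite /= in_itv/= andbT => t0; rewrite lee_fin normrM.
  have e0 : 0 <= expR (- (n%:R * h) * t) := expR_ge0 _.
  have e1 : expR (- (n%:R * h) * t) <= 1.
    by rewrite -expR0 ler_expR mulNr oppr_le0; do 2?apply: mulr_ge0 => //; exact: ltW.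
  rewrite ler_piMl// ger0_norm ?exprn_ge0 ?exprn_ile1// ?subr_ge0//.
have [_ _] := dominated_convergence mtime (fun n => measurable_int _ (fi n).1)
  mF cF (integrable_abse Gi) fle.
rewrite (_ : (fun n => _) = fun=> 0%E); last first.
  apply/funext => n; rewrite -[LHS]fineK; last exact: integrable_fin_num (fi n).1.
  by congr EFin; exact: (fi n).2.
move=> /(cvg_unique _ (cvg_cst _))/= /(_ _)/esym F0.
rewrite /Rintegral.
have -> : (\int[mu]_(t in `]a, +oo[) (G t)%:E = \int[mu]_(t in time) F t)%E.
  rewrite /F -integral_mkcondr; congr (integral _ _ _).
  apply/seteqP; split=> t /=; rewrite !in_itv/= !andbT; last by case.
  by move=> at'; split=> //; rewrite ltW// (lt_trans a0).
by rewrite F0.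
Qed.

(** The whole integral and all tails of [G] vanish, so the primitive of its extension by zero is
    identically 0. Lebesgue differentiation returns [G = 0] almost everywhere, and the exponential
    factor of [G] is never 0. *)
Lemma laplace_real_eq0 : {ae mu, forall t, time t -> g t = 0}.
Proof.
pose G0 : R -> R := G \_ time.
have E0 : \int[mu]_(t in time) G t = 0 by apply: g0; rewrite ltrDl.
have i0 : mu.-integrable setT (EFin \o G0).
  by have := (integrable_mkcond _ mtime).1 Gi; rewrite restrict_EFin.
have iS (D : set T) : measurable D -> mu.-integrable D (EFin \o G0).
  by move=> mD; apply: integrableS i0.
have F0 x : \int[mu]_(t in `]-oo, x]) G0 t = 0.
  have [x0|x0] := ltP x 0.
    transitivity (\int[mu]_(t in `]-oo, x]) (0 : R)).
      apply: eq_Rintegral => t; rewrite inE/= in_itv/= => tx.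
      rewrite /G0 patchE memNset//= in_itv/= andbT; apply/negP; rewrite -ltNge.
      exact: le_lt_trans tx x0.
    by rewrite /Rintegral integral0.
  have tail0 : \int[mu]_(t in `]x, +oo[) G0 t = 0.
    transitivity (\int[mu]_(t in `]x, +oo[) G t).
      apply: eq_Rintegral => t; rewrite inE/= in_itv/= andbT => tx.
      by rewrite /G0 patchE mem_set//= in_itv/= andbT (le_trans x0)// ltW.
    move: x0; rewrite le_eqVlt => /predU1P[<-|]; last exact: tail_integral.
    rewrite Rintegral_itv_obnd_cbnd// -/time.
    apply: integrableS Gi => //.
    by move=> t /=; rewrite !in_itv/= !andbT => /ltW.
  have iT := iS _ (@measurable_itv R `]-oo, +oo[%R).
  have h1 : (-oo <= BRight x)%O by [].
  have h2 : (BRight x <= +oo)%O by [].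
  have := Rintegral_itvB iT h1 h2.
  rewrite tail0 set_itvNyy -[X in X - _]Rintegral_mkcond E0 sub0r => /eqP.
  by rewrite oppr_eq0 => /eqP.
have iNy (y : R) := iS _ (@measurable_itv R `]-oo, y]%R).
have lG0 : locally_integrable setT G0 by exact: integrable_locally.
have := FTC1Ny iNy lG0; apply: filterS; first exact: (ae_filter_ringOfSetsType mu).
move=> x [_].
under [X in X^`()]eq_fun do rewrite F0.
rewrite derive1_cst => /esym; rewrite /G0 patchE => h tx; move: h.
rewrite mem_set// /G => /eqP; rewrite mulf_eq0 gt_eqF ?expR_gt0//= => /eqP.
by [].
Qed.

End RealSignal.
End LaplaceUniqueness.

(** * Realization of transfer matrices *)

Section Signals.
Local Open Scope classical_set_scope.
Context {R : realType}.
Local Notation C := R[i].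
Local Notation T := (measurableTypeR R).
Local Notation mu := (@lebesgue_measure R).
Local Notation time := (`[0%R, +oo[%classic : set T).
Implicit Types (f g : T -> C) (s r c : C).

Let mtime : measurable time. Proof. exact: measurable_itv. Qed.

Definition slaplace f s : C := cint mu time (fun t => cexp (- (s * t%:C)) * f t).

Lemma L2signalD f g : L2signal f -> L2signal g -> L2signal (fun t => f t + g t).
Proof.
move=> [mf fi] [mg gi]; have mfg := cmeasurableD mf mg; split=> //.
apply: le_integrable (integrableD mtime (integrableZl mtime 2 fi)
  (integrableZl mtime 2 gi)) => //.
  by apply/measurable_EFinP/measurable_funX/measurable_normc.
move=> t _; rewrite /= lee_fin !ger0_norm ?addr_ge0 ?mulr_ge0 ?sqr_ge0 ?normc_ge0//.
have h := normcD (f t) (g t); have h0 := normc_ge0 (f t + g t).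
apply: (@le_trans _ _ ((normc (f t) + normc (g t)) ^+ 2)).
  by rewrite lerXn2r ?nnegrE ?addr_ge0 ?normc_ge0.
rewrite -subr_ge0.
have -> : 2 * normc (f t) ^+ 2 + 2 * normc (g t) ^+ 2 - (normc (f t) + normc (g t)) ^+ 2
  = (normc (f t) - normc (g t)) ^+ 2 by ring.
exact: sqr_ge0.
Qed.

Lemma L2signalZ f c : L2signal f -> L2signal (fun t => c * f t).
Proof.
move=> [mf fi]; split; first by apply: cmeasurableM => //; exact: cmeasurable_cst.
apply: eq_integrable (integrableZl mtime (normc c ^+ 2) fi) => // t _.
by rewrite normcM exprMn.
Qed.

Lemma L2signal0 : L2signal (fun=> 0 : C).
Proof.
split; first exact: cmeasurable_cst.
by apply: eq_integrable (integrable0 mu time) => // t _; rewrite normc0 expr0n.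
Qed.

Lemma L2signal_Re f : L2signal f -> L2signal (fun t => (complex.Re (f t))%:C).
Proof.
move=> [mf fi]; split; first by apply: cmeasurable_real; case: mf.
apply: le_integrable fi => //.
  apply/measurable_EFinP/measurable_funX/measurable_normc.
  by apply: cmeasurable_real; case: mf.
move=> t _; rewrite /= lee_fin !ger0_norm ?sqr_ge0// lerXn2r ?nnegrE ?normc_ge0 ?sqrtr_ge0//.
by rewrite expr0n addr0 sqrtr_sqr normc_geRe.
Qed.

Lemma slaplaceD f g s : 0 < complex.Re s -> L2signal f -> L2signal g ->
  slaplace (fun t => f t + g t) s = slaplace f s + slaplace g s.
Proof.
move=> s0 fL gL; rewrite /slaplace; under eq_cint do rewrite mulrDr.
by rewrite cintD//; exact: L2signal_laplace.
Qed.

Lemma slaplaceZ f c s : 0 < complex.Re s -> L2signal f ->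
  slaplace (fun t => c * f t) s = c * slaplace f s.
Proof.
move=> s0 fL; rewrite /slaplace; under eq_cint do rewrite mulrCA.
by rewrite cintZ//; exact: L2signal_laplace.
Qed.

Lemma slaplace0 s : slaplace (fun=> 0) s = 0.
Proof. by rewrite /slaplace; under eq_cint do rewrite mulr0; exact: cint0. Qed.

Lemma slaplace_sum (I : Type) (rs : seq I) (f : I -> T -> C) :
  (forall i, L2signal (f i)) ->
  L2signal (fun t => \sum_(i <- rs) f i t) /\
  forall s, 0 < complex.Re s ->
    slaplace (fun t => \sum_(i <- rs) f i t) s = \sum_(i <- rs) slaplace (f i) s.
Proof.
move=> fL; elim: rs => [|i rs [IH1 IH2]].
  have -> : (fun t => \sum_(i <- [::]) f i t) = (fun=> 0).
    by apply/funext => t; rewrite big_nil.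
  split; first exact: L2signal0.
  by move=> s _; rewrite big_nil slaplace0.
have -> : (fun t => \sum_(j <- i :: rs) f j t) =
    (fun t => f i t + \sum_(j <- rs) f j t).
  by apply/funext => t; rewrite big_cons.
split; first exact: L2signalD.
by move=> s s0; rewrite big_cons slaplaceD// IH2.
Qed.

Lemma L2signalJ f : L2signal f -> L2signal (fun t => conjc (f t)).
Proof.
move=> [[m1 m2] fi]; split.
  split; first by apply: eq_measurable_fun m1 => t _; rewrite cReJ.
  by apply: eq_measurable_fun (measurable_funN m2) => t _; rewrite cImJ.
apply: eq_integrable fi => // t _.
by rewrite [normc (conjc _)]normcE2 cReJ cImJ sqrrN -normcE2.
Qed.

Lemma conjcM (x y : C) : conjc (x * y) = conjc x * conjc y.
Proof. by apply: complexP; case: x y => a b [c d]; rewrite /=; ring. Qed.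

Lemma slaplaceJ f s : 0 < complex.Re s -> L2signal f ->
  slaplace (fun t => (f t)^*) s = (slaplace f s^*)^*.
Proof.
move=> s0 fL; rewrite /slaplace -cintJ//; last by apply: L2signal_laplace; rewrite ?cReJ.
apply: eq_cint => t _; rewrite conjcM -cexpJ; congr (cexp _ * _).
by apply: complexP; case: s s0 => a b _; rewrite /=; ring.
Qed.

(** Only the existence of an L2 output for each input is recorded, not an operator; adding and
    chaining outputs then gives closure under sums and products. *)
Definition realizable (G : C -> C) := forall f, L2signal f ->
  exists2 y, L2signal y &
    forall s, 0 < complex.Re s -> slaplace y s = G s * slaplace f s.

Lemma eq_realizable (G H : C -> C) : (forall s, 0 < complex.Re s -> G s = H s) ->
  realizable G -> realizable H.
Proof. by move=> GH Gr f /Gr[y yL yE]; exists y => // s s0; rewrite yE// GH. Qed.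

Lemma realizable_cst c : realizable (fun=> c).
Proof.
move=> f fL; exists (fun t => c * f t); first exact: L2signalZ.
by move=> s s0; rewrite slaplaceZ.
Qed.

Lemma realizableD (G H : C -> C) : realizable G -> realizable H ->
  realizable (fun s => G s + H s).
Proof.
move=> Gr Hr f fL; have [y yL yE] := Gr f fL; have [z zL zE] := Hr f fL.
exists (fun t => y t + z t); first exact: L2signalD.
by move=> s s0; rewrite slaplaceD// yE// zE// mulrDl.
Qed.

Lemma realizableM (G H : C -> C) : realizable G -> realizable H ->
  realizable (fun s => G s * H s).
Proof.
move=> Gr Hr f fL; have [y yL yE] := Hr f fL; have [z zL zE] := Gr y yL.
by exists z => // s s0; rewrite zE// yE// mulrA.
Qed.

Lemma realizable_pole r : complex.Re r < 0 -> realizable (fun s => (s - r)^-1).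
Proof.
move=> r0 f fL; have [y yL yE] := first_order_filter r0 fL.
by exists y => // s s0; rewrite /slaplace yE// mulrC.
Qed.

(** Poles are peeled off one at a time: [p = p' (s - r) + p(r)] gives [p / ((s - r) q) = p' / q + (s
    - r)^-1 (p(r) / q)]. Multiple poles arise as products and need no separate treatment. *)
Lemma realizable_ratio (p q : {poly C}) : hurwitz q -> (size p <= size q)%N ->
  realizable (fun s => p.[s] / q.[s]).
Proof.
move=> hq pq; have [rs [qE sq ars]] := hurwitz_factor hq.
have q0 : (0 < size q)%N by rewrite size_poly_gt0 hurwitz_neq0.
have {pq q0}: (size p <= (size rs).+1)%N by rewrite sq prednK.
suff h (p' : {poly C}) : (size p' <= (size rs).+1)%N ->
    realizable (fun s => p'.[s] / \prod_(z <- rs) (s - z)).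
  move=> /h/(realizableM (realizable_cst (lead_coef q)^-1)); apply: eq_realizable.
  move=> s _; rewrite mulrCA {2}qE hornerZ horner_prod invfM; congr (_ * (_ / _)).
  by apply: eq_bigr => z _; rewrite hornerXsubC.
elim: rs ars {qE sq p} p' => [_ p /size1_polyC->|r rs IH /= /andP[r0 ars] p sp].
  by apply: eq_realizable (realizable_cst p`_0) => s _; rewrite hornerC big_nil divr1.
have /factor_theorem[p' p'E] : root (p - p.[r]%:P) r.
  by rewrite /root hornerD hornerN hornerC subrr.
have sp' : (size p' <= (size rs).+1)%N.
  have [->|p'0] := eqVneq p' 0; first by rewrite size_poly0.
  have : (size (p - p.[r]%:P)%R <= (size rs).+2)%N.
    rewrite (leq_trans (size_polyD _ _))// geq_max sp size_polyN.
    by rewrite (leq_trans (size_polyC_leq1 _)).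
  by rewrite p'E size_Mmonic ?monicXsubC// size_XsubC addn2.
apply: eq_realizable (realizableD (IH ars p' sp') (realizableM (realizable_pole r0)
  (IH ars (p.[r]%:P) (leq_trans (size_polyC_leq1 _) _)))) => // s s0.
have sr : s - r != 0.
  apply/eqP => /(congr1 (@complex.Re R)); rewrite cReD cReN /=; lra.
have -> : p.[s] = p'.[s] * (s - r) + p.[r].
  have := congr1 (fun x => x.[s]) p'E.
  by rewrite hornerD hornerN hornerC hornerM hornerXsubC => <-; rewrite subrK.
rewrite big_cons hornerC invfM mulrDl; congr (_ + _); last by rewrite mulrCA.
by rewrite !mulrA mulfK.
Qed.

(* Lerch's theorem. *)
Lemma slaplace_inj f g (sigma : R) :
  (forall s, sigma < complex.Re s ->
    [/\ cintegrable mu time (fun t => cexp (- (s * t%:C)) * f t),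
        cintegrable mu time (fun t => cexp (- (s * t%:C)) * g t) &
        slaplace f s = slaplace g s]) ->
  {ae mu, forall t, time t -> f t = g t}.
Proof.
move=> h.
have eE (s : R) (t : T) : cexp (- (s%:C * (t : R)%:C)) = (expR (- s * t))%:C.
  by rewrite -rmorphM -rmorphN cexp_real mulNr.
have hd (s : R) : sigma < s ->
    cintegrable mu time (fun t => (expR (- s * t))%:C * (f t - g t)) /\
    cint mu time (fun t => (expR (- s * t))%:C * (f t - g t)) = 0.
  move=> ss; have [fi gi fg] := h s%:C ss.
  have E t : cexp (- (s%:C * (t : R)%:C)) * f t + -1 * (cexp (- (s%:C * (t : R)%:C)) * g t)
    = (expR (- s * t))%:C * (f t - g t) by rewrite eE; ring.
  split.
    by apply: eq_cintegrable (cintegrableD mtime fi (cintegrableZ (-1) mtime gi)).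
  under eq_cint do rewrite -E.
  rewrite cintD//; last exact: cintegrableZ.
  by rewrite cintZ// -/(slaplace f s%:C) -/(slaplace g s%:C) fg mulN1r subrr.
have ReE (s : R) (t : T) : complex.Re ((expR (- s * t))%:C * (f t - g t)) =
    expR (- s * t) * complex.Re (f t - g t) by rewrite cReM /= mul0r subr0.
have ImE (s : R) (t : T) : complex.Im ((expR (- s * t))%:C * (f t - g t)) =
    expR (- s * t) * complex.Im (f t - g t) by rewrite cImM /= mul0r addr0.
have re0 : {ae mu, forall t, time t -> complex.Re (f t - g t) = 0}.
  apply: (@laplace_real_eq0 R (fun t => complex.Re (f t - g t)) sigma) => s /hd[[i _] e].
    by apply: eq_integrable i => // t _; rewrite ReE.
  under eq_Rintegral do rewrite -ReE.
  by rewrite -cint_Re e.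
have im0 : {ae mu, forall t, time t -> complex.Im (f t - g t) = 0}.
  apply: (@laplace_real_eq0 R (fun t => complex.Im (f t - g t)) sigma) => s /hd[[_ i] e].
    by apply: eq_integrable i => // t _; rewrite ImE.
  under eq_Rintegral do rewrite -ImE.
  exact: (congr1 (@complex.Im R) e).
have [N1 [mN1 N10 s1]] := re0; have [N2 [mN2 N20 s2]] := im0.
exists (N1 `|` N2); split; [exact: measurableU|exact: null_set_setU|].
move=> t /= ht; apply: contrapT => /not_orP[n1 n2]; apply: ht => tt.
apply/eqP; rewrite -subr_eq0; apply/eqP; apply: complexP.
  by apply: contrapT => hr; apply: n1; apply: s1 => /(_ tt).
by apply: contrapT => hi; apply: n2; apply: s2 => /(_ tt).
Qed.

(** Carries square integrability from the constructed response to any other signal with the same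
    transform, by almost everywhere equality. *)
Lemma L2signal_slaplace_eq f g (sigma : R) :
  (forall s, sigma < complex.Re s ->
    [/\ cintegrable mu time (fun t => cexp (- (s * t%:C)) * f t),
        cintegrable mu time (fun t => cexp (- (s * t%:C)) * g t) &
        slaplace f s = slaplace g s]) ->
  L2signal g -> L2signal f.
Proof.
move=> h [mg gi].
have fg := slaplace_inj h.
have mf : cmeasurable time f.
  (* [f] is measurable because its damped version is, at any point to the right of [sigma]. *)
  have [|i _ _] := h (sigma + 1)%:C; first by rewrite /= ltrDl.
  apply: (eq_cmeasurable _ (cmeasurableM (cmeasurable_cexp (cmeasurableM
    (cmeasurable_cst time ((sigma + 1)%:C : C))
    (cmeasurable_real (@measurable_id _ T time)))) (cintegrable_measurable i))) => t _.
  by rewrite mulrA -cexpD subrr cexp0 mul1r.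
split=> //; apply/integrableP; split.
  by apply/measurable_EFinP/measurable_funX/measurable_normc.
have [_ hg] := integrableP _ _ _ gi.
apply: le_lt_trans hg; rewrite le_eqVlt; apply/orP; left; apply/eqP.
apply: ae_eq_integral => //.
- by apply: measurableT_comp => //; apply/measurable_EFinP/measurable_funX/measurable_normc.
- by apply: measurableT_comp => //; apply/measurable_EFinP/measurable_funX/measurable_normc.
- have [N [mN N0 sN]] := fg; exists N; split=> // t /= ht.
  by apply: sN => ft; apply: ht => tt; rewrite ft.
Qed.

Lemma L2_L2signal n (u : R -> 'cV[C]_n) :
  L2 u <-> forall k, L2signal (fun t : T => u t k 0).
Proof.
have mn (mu0 : forall k, cmeasurable time (fun t : T => u t k 0)) k :
    measurable_fun time (fun t : T => (normc (u t k 0) ^+ 2)).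
  by apply: measurable_funX; exact: measurable_normc.
split=> [[mu0 ui] k|uL].
  have mk k' : cmeasurable time (fun t : T => u t k' 0) by exact: mu0.
  split=> //; apply/integrableP; split.
    by apply/measurable_EFinP; exact: (mn mk k).
  apply: le_lt_trans ui; apply: ge0_le_integral => //.
  - by apply: measurableT_comp => //; apply/measurable_EFinP; exact: (mn mk k).
  - apply/measurable_EFinP.
    apply: (eq_measurable_fun (fun t : T => \sum_k normc (u t k 0) ^+ 2)).
      by move=> t _; rewrite -rdotxx.
    by apply: measurable_sum => k'; exact: (mn mk).
  - move=> t _; rewrite /= lee_fin ger0_norm ?sqr_ge0//.
    rewrite -/(rdot _ _) rdotxx (bigD1 k)//= lerDl sumr_ge0// => j _.
    exact: sqr_ge0.
split; first by move=> k; case: (uL k).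
have := @integrable_sum _ T R mu time mtime _ (index_enum 'I_n) xpredT
  (fun k t => (normc (u t k 0) ^+ 2)%:E) (fun k _ => (uL k).2).
move=> /(integrable_lty mtime).
by under eq_integral do rewrite sumEFin -rdotxx.
Qed.

Lemma laplaceE n (u : R -> 'cV[C]_n) s k : laplace u s k 0 = slaplace (fun t => u t k 0) s.
Proof. by rewrite mxE. Qed.

Lemma L2_laplace_cvg n (u : R -> 'cV[C]_n) s : L2 u -> 0 < complex.Re s ->
  laplace_cvg u s.
Proof. by move=> /L2_L2signal uL s0 k; exact: L2signal_laplace s0 (uL k). Qed.

Lemma L2B n (u v : R -> 'cV[C]_n) : L2 u -> L2 v -> L2 (fun t => u t - v t).
Proof.
move=> /L2_L2signal uL /L2_L2signal vL; apply/L2_L2signal => k.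
have := L2signalD (uL k) (L2signalZ (-1) (vL k)).
by congr L2signal; apply/funext => t; rewrite !mxE mulN1r.
Qed.

Lemma laplaceB n (u v w : R -> 'cV[C]_n) s : laplace_cvg u s -> laplace_cvg v s ->
  (forall t, 0 <= t -> w t = u t - v t) -> laplace w s = laplace u s - laplace v s.
Proof.
move=> uc vc wE; apply/matrixP => k j; rewrite ord1 [RHS]mxE [X in _ + X]mxE !laplaceE.
rewrite -mulN1r /slaplace -cintZ//; last exact: vc.
rewrite -cintD//; [|exact: uc|by apply: cintegrableZ => //; exact: vc].
apply: eq_cint => t; rewrite inE/= in_itv/= andbT => t0.
by rewrite wE// !mxE; ring.
Qed.

Definition conj_symmetric n (G : C -> 'M[C]_n) :=
  forall s, 0 < complex.Re s -> G s^* = map_mx conjc (G s).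

(* For real signals, the real part of a complex response is again a response,
   because G and the input transform commute with complex conjugation. *)
Lemma realizable_matrix F n (G : C -> 'M[C]_n) (u : R -> 'cV[C]_n) :
  (forall i j, realizable (fun s => G s i j)) -> conj_symmetric G ->
  valued F u -> L2 u ->
  exists y, [/\ valued F y, L2 y &
    forall s, 0 < complex.Re s -> laplace y s = G s *m laplace u s].
Proof.
move=> Gr Gc uF /L2_L2signal uL.
have /choice[v hv] : forall ij : 'I_n * 'I_n, exists y : T -> C, L2signal y /\
    forall s, 0 < complex.Re s ->
      slaplace y s = G s ij.1 ij.2 * slaplace (fun t => u t ij.2 0) s.
  by move=> [i j]; have [y yL yE] := Gr i j _ (uL j); exists y.
pose y (t : R) : 'cV[C]_n := \col_i \sum_j v (i, j) t.
have ys i := @slaplace_sum _ (index_enum 'I_n) (fun j => v (i, j)) (fun j => (hv (i, j)).1).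
have yk i : (fun t => y t i 0) = (fun t => \sum_j v (i, j) t).
  by apply/funext => t; rewrite mxE.
have yL : forall i, L2signal (fun t : T => y t i 0).
  by move=> i; rewrite yk; case: (ys i).
have yE s : 0 < complex.Re s -> laplace y s = G s *m laplace u s.
  move=> s0; apply/matrixP => i j; rewrite ord1 laplaceE yk mxE.
  have [_ ->//] := ys i.
  by apply: eq_bigr => j' _; rewrite laplaceE; have [_ ->] := hv (i, j').
case: F uF => [uF|_]; last by exists y; split=> //; exact/L2_L2signal.
pose x (t : R) : 'cV[C]_n := \col_i (complex.Re (y t i 0))%:C.
have xk i : (fun t => x t i 0) = (fun t => (complex.Re (y t i 0))%:C).
  by apply/funext => t; rewrite mxE.
exists x; split.
- by move=> t k _; rewrite mxE.
- by apply/L2_L2signal => i; rewrite xk; exact: L2signal_Re.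
move=> s s0; have s0' : 0 < complex.Re s^* by rewrite cReJ.
have uJ : map_mx conjc (laplace u s^*) = laplace u s.
  apply/matrixP => k j; rewrite ord1 mxE !laplaceE -slaplaceJ//.
  apply: eq_cint => t; rewrite inE/= in_itv/= andbT => t0; congr (_ * _).
  by apply: complexP; rewrite ?cReJ ?cImJ// uF// oppr0.
have yJ : map_mx conjc (laplace y s^*) = laplace y s.
  by rewrite !yE// map_mxM uJ Gc// -map_mx_comp map_mx_id// => z; exact: conjcK.
rewrite -yE//; apply/matrixP => k j; rewrite ord1 !laplaceE xk.
have -> : (fun t => (complex.Re (y t k 0))%:C) =
    (fun t => 2^-1 * (y t k 0 + conjc (y t k 0))).
  by apply/funext => t; rewrite addcJ mulKf// pnatr_eq0.
have yJL := L2signalJ (yL k).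
rewrite slaplaceZ//; last exact: L2signalD.
rewrite slaplaceD// slaplaceJ//.
have -> : conjc (slaplace (fun t => y t k 0) s^*) = slaplace (fun t => y t k 0) s.
  by have := congr1 (fun M : 'cV[C]_n => M k 0) yJ; rewrite mxE !laplaceE.
by rewrite -mulr2n -[X in 2^-1 * X]mulr_natl mulKf// pnatr_eq0.
Qed.

End Signals.

(** * Stability of the closed loop on signals *)

Section ClosedLoop.
Context {R : realType}.
Local Notation C := R[i].

Lemma RHoo_realizable n (H : C -> 'M[C]_n) : RHoo H ->
  (forall i j, realizable (fun s => H s i j)) /\ conj_symmetric H.
Proof.
move=> hH; have [D [N [hD sN HE]]] := RHoo_common_denominator hH.
split; last by move=> s s0; apply: (RHoo_conj hH); exact: ltW.
move=> i j; apply: eq_realizable (realizable_ratio hD (sN i j)) => s s0.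
by rewrite HE ?ltW// !mxE mulrC.
Qed.

Lemma closed_loop_realizable n (H1 H2 : C -> 'M[C]_n) (hH1 : RHoo H1) (hH2 : RHoo H2)
    (hfreq : forall w : R, 0 <= w ->
       phase_condition (H1 (jw w)) (H2 (jw w)) \/
       gain_condition (H1 (jw w)) (H2 (jw w)))
    (hinfty :
       phase_condition (at_infty H1) (at_infty H2) \/
       gain_condition (at_infty H1) (at_infty H2)) :
  exists Tc : C -> 'M[C]_n,
    [/\ forall i j, realizable (fun s => Tc s i j), conj_symmetric Tc &
     forall s, 0 < complex.Re s -> (1%:M + H1 s *m H2 s \in unitmx) /\
       (1%:M + H1 s *m H2 s) *m Tc s = H1 s].
Proof.
have [D [N [hD sN TE]]] := closed_loop_rational hH1 hH2 hfreq hinfty.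
exists (fun s => invmx (1%:M + H1 s *m H2 s) *m H1 s); split.
- move=> i j; apply: eq_realizable (realizable_ratio hD (sN i j)) => s s0.
  by have [_ ->] := TE s (ltW s0); rewrite !mxE mulrC.
- move=> s /ltW s0; rewrite (RHoo_conj hH1 s0) (RHoo_conj hH2 s0).
  by rewrite map_mxM map_invmx map_mxD map_mx1 map_mxM.
- move=> s /ltW s0; have [d0 _] := TE s s0.
  have U : 1%:M + H1 s *m H2 s \in unitmx by rewrite unitmxE unitfE.
  by split=> //; rewrite mulKVmx.
Qed.

End ClosedLoop.

Theorem theorem5 (R : realType) (F : scalar_field) (n : nat)
    (H1 H2 : R[i] -> 'M[R[i]]_n)
    (hH1 : RHoo H1) (hH2 : RHoo H2)
    (hfreq : forall w : R, 0 <= w ->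
       phase_condition (H1 (jw w)) (H2 (jw w)) \/
       gain_condition (H1 (jw w)) (H2 (jw w)))
    (hinfty :
       phase_condition (at_infty H1) (at_infty H2) \/
       gain_condition (at_infty H1) (at_infty H2)) :
  L2_stable F (closed_loop F H1 H2).
Proof.
have [Tc [Tr Ts TE]] := closed_loop_realizable hH1 hH2 hfreq hinfty.
have [H2r H2s] := RHoo_realizable hH2.
move=> u uF uL; have [y [yF yL yE]] := realizable_matrix Tr Ts uF uL.
split.
  exists y => //.
  have [z [zF zL zE]] := realizable_matrix H2r H2s yF yL.
  have eL := L2B uL zL.
  (* The loop is rebuilt from its output: [y = Tc u] gives [z = H2 y], then [e = u - z]. *)
  exists (fun t => u t - z t), z; split=> //.
  - split=> //; case: F uF zF {yF} => // uF zF t k t0.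
    by rewrite !mxE cImD cImN uF// zF// subrr.
  - exists 0 => // s s0; split; [exact: L2_laplace_cvg|exact: L2_laplace_cvg|exact: zE].
  - exists 0 => // s s0; split; [exact: L2_laplace_cvg|exact: L2_laplace_cvg|].
    have eU : laplace (fun t => u t - z t) s = laplace u s - laplace z s.
      exact: (laplaceB (L2_laplace_cvg uL s0) (L2_laplace_cvg zL s0)).
    (* [(1 + H1 H2) Tc = H1] is read as [Tc = H1 - H1 H2 Tc]. *)
    rewrite eU zE// yE// mulmxBr; have [_ TcE] := TE s s0.
    apply/eqP; rewrite eq_sym subr_eq; apply/eqP.
    by rewrite -{1}TcE mulmxDl mul1mx mulmxDl !mulmxA.
move=> x xF [e [z [[eF zF] [s2 s20 h2] eE [s1 s10 h1]]]].
apply/L2_L2signal => k.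
(* The two response relations may hold on different half-planes; [sg] delimits a common one. *)
pose sg := Num.max s1 s2.
have sg0 : 0 <= sg by rewrite le_max s10.
apply: (@L2signal_slaplace_eq _ _ (fun t => y t k 0) sg); last exact: (L2_L2signal y).1.
move=> s ss; have s0 : 0 < complex.Re s := le_lt_trans sg0 ss.
have [|ec xc xE] := h1 s; first by apply: le_lt_trans ss; rewrite le_max lexx.
have [|_ zc zE] := h2 s; first by apply: le_lt_trans ss; rewrite le_max lexx orbT.
split; [exact: xc|exact: (L2_laplace_cvg yL s0)|].
rewrite -!laplaceE; congr (fun_of_matrix _ k 0).
(* Eliminating [e] and [z] gives [(1 + H1 H2) x = H1 u] between transforms, the equation that [y]
   also satisfies; the invertible factor cancels. *)
have [U TcE] := TE s s0; apply: (can_inj (mulKmx U)).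
rewrite yE// mulmxA TcE mulmxDl mul1mx {1}xE.
rewrite (laplaceB (L2_laplace_cvg uL s0) zc eE) mulmxBr zE.
by rewrite [H1 s *m (H2 s *m _)]mulmxA subrK.
Qed.
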